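(* Let $G$ be a graph with a length-function $\ell$ and let $C\subseteq G$ be a cycle. If $C$ is $6$-geodesic in $G$, then $C$ is fully geodesic in $G$.
   Context: All graphs are finite; parallel edges are allowed, loops are not; a cycle may consist of two vertices joined by two parallel edges. A length-function on a graph $G$ is a map $\ell:E(G)\to\mathbb{R}^+$ (strictly positive reals); for a subgraph $H$ put $\ell(H)=\sum_{e\in E(H)}\ell(e)$, and subgraphs carry the restricted length-function. For $A\subseteq V(G)$, the Steiner distance $\mathrm{sd}_G(A)$ is the minimum of $\ell(S)$ over all connected subgraphs $S\subseteq G$ with $A\subseteq V(S)$ ($\infty$ if none exists). A subgraph $H\subseteq G$ is $k$-geodesic in $G$ if $\mathrm{sd}_H(A)=\mathrm{sd}_G(A)$ for every $A\subseteq V(H)$ with $|A|\le k$; it is fully geodesic in $G$ if it is $k$-geodesic for every $k\in\mathbb{N}$. *)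

(* Defs.v *)
From HB Require Import structures.
From mathcomp Require Import all_boot all_order all_algebra.
Set Implicit Arguments. Unset Strict Implicit. Unset Printing Implicit Defensive.
Import Order.TTheory GRing.Theory Num.Theory.
Local Open Scope ring_scope.

(* A multigraph G: vertex type V, edge type E, each edge e has ends (ends e).1
   and (ends e).2 (loops excluded by a hypothesis in the theorem; parallel
   edges allowed).  A subgraph is given by a vertex set and an edge set. *)

Section Graphs.
Variables (V E : finType) (ends : E -> V * V).

Definition incident (e : E) (v : V) : bool := ((ends e).1 == v) || ((ends e).2 == v).

Definition is_subgraph (VS : {set V}) (ES : {set E}) (VH : {set V}) (EH : {set E}) : Prop :=
  [/\ VS \subset VH, ES \subset EH &
      forall e, e \in ES -> ((ends e).1 \in VS) && ((ends e).2 \in VS)].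

Definition adj (ES : {set E}) : rel V :=
  [rel x y | [exists e in ES, (ends e == (x, y)) || (ends e == (y, x))]].

(* the graph (VS, ES) is connected: any two of its vertices are joined by a
   walk using edges of ES (the empty graph counts as connected) *)
Definition connected_sub (VS : {set V}) (ES : {set E}) : Prop :=
  forall x y, x \in VS -> y \in VS -> connect (adj ES) x y.

(* (VC, EC) is a cycle: a nonempty connected graph in which every vertex has
   degree exactly 2 (with no loops this is exactly a cycle; a 2-cycle consists
   of two vertices joined by two parallel edges). *)
Definition is_cycle (VC : {set V}) (EC : {set E}) : Prop :=
  [/\ VC != set0,
      forall e, e \in EC -> ((ends e).1 \in VC) && ((ends e).2 \in VC),
      connected_sub VC EC &
      forall v, v \in VC -> #|[set e in EC | incident e v]| = 2%N].

Variable R : realFieldType.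
Variable l : E -> R.

Definition len (ES : {set E}) : R := \sum_(e in ES) l e.

Definition steiner_witness (VH : {set V}) (EH : {set E}) (A : {set V}) (d : R) : Prop :=
  exists (VS : {set V}) (ES : {set E}),
    [/\ is_subgraph VS ES VH EH, connected_sub VS ES, A \subset VS & len ES = d].

(* sd_H(A) = d  (the minimum is attained, since H is finite) *)
Definition is_sd (VH : {set V}) (EH : {set E}) (A : {set V}) (d : R) : Prop :=
  steiner_witness VH EH A d /\ (forall d', steiner_witness VH EH A d' -> d <= d').

(* sd_H(A) = sd_G(A) as values in R ∪ {∞}: they have the same (possibly
   nonexistent, i.e. infinite) value. G is the whole graph ([set: V], [set: E]). *)
Definition sd_eq_G (VH : {set V}) (EH : {set E}) (A : {set V}) : Prop :=
  forall d, is_sd VH EH A d <-> is_sd [set: V] [set: E] A d.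

Definition k_geodesic (k : nat) (VH : {set V}) (EH : {set E}) : Prop :=
  forall A : {set V}, A \subset VH -> (#|A| <= k)%N -> sd_eq_G VH EH A.

Definition fully_geodesic (VH : {set V}) (EH : {set E}) : Prop :=
  forall k : nat, k_geodesic k VH EH.

End Graphs.

(* Main.v *)
Require Import Defs.
From HB Require Import structures.
From mathcomp Require Import all_boot all_order all_algebra.
From mathcomp Require Import zify lra.
Import Order.TTheory GRing.Theory Num.Theory.
Local Open Scope ring_scope.
Set Implicit Arguments. Unset Strict Implicit. Unset Printing Implicit Defensive.

(* Let [A] be a smallest set of terminals on the cycle [C] that some connected
   [F] in [G] joins more cheaply than [C] does; then [#|A| > 6].  Write [lam] for
   the length of [C] and [t] for that of [F].  The Steiner distance of [B] in [C]
   is [lam] minus the longest gap of [B], so every gap of [A] is shorter than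
   [lam - t], while every proper subset of [A] obeys the reverse inequality.

   A tree with more than 6 leaves has an edge with at least 3 leaves on each
   side.  Hence [F] contains edge-disjoint pieces joining [P] and [Q] to a vertex
   [u1], [P'] and [Q'] to [u2], and [u1] to [u2], where [P], [Q], [P'], [Q']
   partition [A] and [#|P + Q|, #|P' + Q'| >= 3].  If a bipartition of [A] into
   [X] and [Y] is realised by disjoint pieces of [F], then the shortest arcs
   around [X] and [Y] are disjoint, since otherwise their union would be too
   short an arc around [A]; so the four sets are consecutive blocks of the
   cyclic order, say [P], [Q], [Q'], [P'].  Adding up the inequalities for
   [P + Q], [P' + Q'], [P + Q'] and [Q + P'], where the last two both use the
   link from [u1] to [u2], gives a contradiction. *)

(** * Gaps of periodic sets *)

(* Keeps only comparisons of naturals: other boolean atoms make [lia] blow up. *)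
Ltac nat_lia :=
  repeat match goal with
  | H : ?P |- _ =>
    lazymatch P with
    | is_true (leq _ _) => fail
    | is_true (andb (leq _ _) (leq _ _)) => fail
    | is_true (orb (leq _ _) _) => fail
    | is_true (orb (orb (leq _ _) _) _) => fail
    | is_true (orb (andb (leq _ _) _) _) => fail
    | @eq nat _ _ => fail
    | not (@eq nat _ _) => fail
    | @eq nat _ _ -> False => fail
    | or (@eq nat _ _) _ => fail
    | nat => fail
    | _ => clear H
    end
  end; lia.

(** Turns an arbitrary goal into a strict inequality over [R], the form in which arithmetic
    contradictions are passed to [lra]. *)
Lemma absurd_lt00 (R : realFieldType) (P : Prop) : (0 : R) < 0 -> P.
Proof. by rewrite ltxx. Qed.

(** A set of places on a circle with [m] places is unrolled to a periodic predicate on [nat], so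
    that cyclic order becomes the usual order inside a window of length [m]. *)
Definition periodic (m : nat) (X : pred nat) := forall k, X (k + m)%N = X k.

Definition gap (X : pred nat) (i j : nat) : Prop :=
  [/\ (i < j)%N, X i, X j & forall k, (i < k < j)%N -> ~~ X k].

Section CircularGaps.
Variables (R : realFieldType) (m : nat) (pos : nat -> R) (lam : R).
Hypothesis m_gt0 : (0 < m)%N.
Hypothesis pos_le : {homo pos : i j / (i <= j)%N >-> i <= j}.
Hypothesis posD : forall i, pos (i + m)%N = pos i + lam.

Lemma periodicMn X q k : periodic m X -> X (k + q * m)%N = X k.
Proof.
move=> perX; elim: q => [|q IH]; first by rewrite mul0n addn0.
by rewrite mulSn [(m + _)%N]addnC addnA perX.
Qed.

Lemma posDMn q k : pos (k + q * m)%N = pos k + lam *+ q.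
Proof.
elim: q => [|q IH]; first by rewrite mul0n addn0 mulr0n addr0.
by rewrite mulSn [(m + _)%N]addnC addnA posD IH mulrSr addrA.
Qed.

(** This is congruence modulo [m], with a multiple of [m] on each side because [k] may lie before or
    after the window and naturals have no negative multiples. *)
Lemma window_shift w k :
  exists k' q q', (w <= k' < w + m)%N /\ (k + q * m = k' + q' * m)%N.
Proof.
(* As [m] is positive, [w * m] is at least [w], so the subtraction is not truncated. *)
exists (w + (k + (w * m - w)) %% m)%N, w, ((k + (w * m - w)) %/ m)%N; split.
  by rewrite leq_addr ltn_add2l ltn_mod.
have := divn_eq (k + (w * m - w)) m.
have : (w <= w * m)%N by rewrite leq_pmulr.
nat_lia.
Qed.

Lemma window_mem w k :
  exists2 k', (w <= k' < w + m)%N & forall X, periodic m X -> X k' = X k.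
Proof.
have [k' [q [q' [wk' E]]]] := window_shift w k.
exists k' => // X perX.
by rewrite -(periodicMn q' k' perX) -E periodicMn.
Qed.

Lemma gap_window w X i j : periodic m X -> gap X i j ->
  exists i' j', [/\ (w <= i' < w + m)%N, gap X i' j' & pos j' - pos i' = pos j - pos i].
Proof.
move=> perX [ij Xi Xj nX].
have [i' [q [q' [wi' E]]]] := window_shift w i.
have Ej : (j + q * m = i' + (j - i) + q' * m)%N by nat_lia.
exists i', (i' + (j - i))%N; split => //.
  split; first nat_lia.
  - by rewrite -(periodicMn q' i' perX) -E periodicMn.
  - by rewrite -(periodicMn q' _ perX) -Ej periodicMn.
  - move=> k ik; rewrite -(periodicMn q' k perX).
    have -> : (k + q' * m = (k - i' + i) + q * m)%N by nat_lia.
    by rewrite periodicMn //; apply: nX; nat_lia.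
have e1 := posDMn q j; have e2 := posDMn q i.
have e3 := posDMn q' i'; have e4 := posDMn q' (i' + (j - i))%N.
rewrite Ej e4 in e1; rewrite E e3 in e2; lra.
Qed.

Lemma gap_bound X i j : periodic m X -> gap X i j -> (j <= i + m)%N.
Proof.
move=> perX [ij Xi Xj nX]; rewrite leqNgt; apply/negP => h.
have /negP := nX (i + m)%N ltac:(nat_lia); by rewrite perX.
Qed.

Lemma gap_shift X i j : periodic m X -> gap X i j -> gap X (i + m) (j + m).
Proof.
move=> perX [ij Xi Xj nX]; split; rewrite ?perX //; first nat_lia.
move=> k ik; have -> : k = (k - m + m)%N by nat_lia.
by rewrite perX; apply: nX; nat_lia.
Qed.

(* [wide X f]: some gap of [X] leaves an arc of length at most [f] that
   contains [X]; that is, the Steiner distance of [X] in the circle is at most [f]. *)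
Definition wide (X : pred nat) (f : R) : Prop :=
  exists i j, gap X i j /\ lam - f <= pos j - pos i.

Section Terminals.
Variables (L : pred nat) (t : R).
Hypothesis t_lt_lam : t < lam.
Hypothesis gapL : forall i j, gap L i j -> pos j - pos i < lam - t.

(* Otherwise the two arcs meet, and their union is too short an arc covering [L]. *)
Lemma split_arcs (X Y : pred nat) f f' :
  periodic m X -> periodic m Y -> (forall k, X k -> ~~ Y k) ->
  (forall k, L k = X k || Y k) -> wide X f -> wide Y f' -> f + f' <= t ->
  exists a b c d, [/\ (a <= b)%N, (b < c)%N, (c <= d)%N & (d < a + m)%N] /\
    [/\ X a, X b, Y c & Y d] /\
    [/\ forall k, (a <= k < a + m)%N -> X k -> (k <= b)%N,
        forall k, (a <= k < a + m)%N -> Y k -> (c <= k <= d)%N,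
        pos b - pos a <= f & pos d - pos c <= f'].
Proof.
move=> perX perY dXY LE [i [j [gX lX]]] [i0 [j0 [gY0 lY0]]] ff.
have [i' [j' [wi' gY eY]]] := gap_window i perY gY0.
rewrite -eY in lY0 => {gY0 eY i0 j0}.
have bX := gap_bound perX gX; have bY := gap_bound perY gY.
have gX' := gap_shift perX gX; have gY' := gap_shift perY gY.
have := gX; case=> ij Xi Xj nX; have := gY; case=> ij' Yi Yj nY.
have := gX'; case=> _ Xim Xjm nX'; have := gY'; case=> _ Yim Yjm nY'.
have XY k l : X k -> Y l -> k <> l by move=> Xk Yl e; subst l; move: (dXY _ Xk); rewrite Yl.
have gapLI u v : (u < v)%N -> L u -> L v ->
   (forall k, (u < k < v)%N -> ~~ X k /\ ~~ Y k) -> pos v - pos u < lam - t.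
  move=> uv Lu Lv H; apply: gapL; split=> // k /H [h1 h2]; by rewrite LE negb_or h1.
have LX k : X k -> L k by rewrite LE => ->.
have LY k : Y k -> L k by rewrite LE orbC => ->.
have tl := t_lt_lam; have e1 := posD i; have e2 := posD j; have e3 := posD i'; have e4 := posD j'.
(* In every case but the last, either the two gaps fit side by side into one turn, or their common
   part is a single gap of [L]; the length count then makes the gaps too long for one turn, or that
   common part at least [lam - t]. *)
have [ji|ij2] := ltnP j i'.
  have [h|h] := leqP j' (i + m).
    have := pos_le (ltnW ji); have := pos_le h.
    move=> *; apply: (@absurd_lt00 R); lra.
  have [h2|h2] := leqP j' (j + m).
    have := gapLI (i + m)%N j' h (LX _ Xim) (LY _ Yj).
    have /[swap]/[apply] : forall k, (i + m < k < j')%N -> ~~ X k /\ ~~ Y k.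
      by move=> k hk; split; [apply: nX' | apply: nY]; nat_lia.
    have := pos_le (ltnW ji); move=> *; apply: (@absurd_lt00 R); lra.
  have := gapLI (i + m)%N (j + m)%N ltac:(nat_lia) (LX _ Xim) (LX _ Xjm).
  have /[swap]/[apply] : forall k, (i + m < k < j + m)%N -> ~~ X k /\ ~~ Y k.
    by move=> k hk; split; [apply: nX' | apply: nY]; nat_lia.
  have := pos_le bY; move=> *; apply: (@absurd_lt00 R); lra.
have {}ij2 : (i' < j)%N by have := XY _ _ Xj Yi; nat_lia.
have [h|h] := leqP j' j.
  have := gapLI i' j' ij' (LY _ Yi) (LY _ Yj).
  have /[swap]/[apply] : forall k, (i' < k < j')%N -> ~~ X k /\ ~~ Y k.
    by move=> k hk; split; [apply: nX | apply: nY]; nat_lia.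
  have := pos_le bX; move=> *; apply: (@absurd_lt00 R); lra.
have [h2|h2] := leqP j' (i + m).
  have := gapLI i' j ij2 (LY _ Yi) (LX _ Xj).
  have /[swap]/[apply] : forall k, (i' < k < j)%N -> ~~ X k /\ ~~ Y k.
    by move=> k hk; split; [apply: nX | apply: nY]; nat_lia.
  have := pos_le h2; move=> *; apply: (@absurd_lt00 R); lra.
(* The gaps now overlap at both ends, so the complementary arc of each lies inside the other gap. *)
exists j, (i + m)%N, j', (i' + m)%N.
split; first by split; nat_lia.
split; first by [].
split; [ | | lra | lra].
- move=> k hk Xk; rewrite leqNgt; apply/negP => hik.
  by have := nX' k ltac:(nat_lia); rewrite Xk.
- move=> k hk Yk; apply/andP; split.
    rewrite leqNgt; apply/negP => hik.
    by have := nY k ltac:(nat_lia); rewrite Yk.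
  rewrite leqNgt; apply/negP => hik.
  have := nY' k ltac:(nat_lia); by rewrite Yk.
Qed.

(** Two sets on disjoint arcs cannot alternate around the circle, and [split_arcs] provides such
    arcs. *)
Lemma noncrossing (X Y : pred nat) f f' :
  periodic m X -> periodic m Y -> (forall k, X k -> ~~ Y k) ->
  (forall k, L k = X k || Y k) -> wide X f -> wide Y f' -> f + f' <= t ->
  forall k1 k2 k3 k4, (k1 < k2 < k3)%N -> (k3 < k4 < k1 + m)%N ->
  X k1 -> Y k2 -> X k3 -> Y k4 -> False.
Proof.
move=> perX perY dXY LE wX wY ff l1 l2 l3 l4 h1 h2 Xl1 Yl2 Xl3 Yl4.
have [a [b [c [d [[ab bc cd da] [[Xa Xb Yc Yd] [hX hY _ _]]]]]]] :=
  split_arcs perX perY dXY LE wX wY ff.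
have [k1 [q [q' [wk E]]]] := window_shift a l1.
(* All four places move by the same multiple of the period, so that the first one falls into the
   window at [a]. *)
pose s l := (k1 + (l - l1))%N.
have sE l : (l1 <= l)%N -> (l + q * m = s l + q' * m)%N by rewrite /s; nat_lia.
have sP Z l : periodic m Z -> (l1 <= l)%N -> Z l -> Z (s l).
  by move=> perZ hl; rewrite -(periodicMn q l perZ) sE // periodicMn.
have Xk1 : X k1 by have := sP X l1 perX (leqnn _) Xl1; rewrite /s subnn addn0.
have Yk2 := sP Y l2 perY ltac:(nat_lia) Yl2.
have Xk3 := sP X l3 perX ltac:(nat_lia) Xl3.
have Yk4 := sP Y l4 perY ltac:(nat_lia) Yl4.
have [{}h1 {}h2] : (k1 < s l2 < s l3)%N /\ (s l3 < s l4 < k1 + m)%N.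
  by rewrite /s; split; nat_lia.
move: (s l2) (s l3) (s l4) Yk2 Xk3 Yk4 h1 h2 => k2 k3 k4 Yk2 Xk3 Yk4 h1 h2.
have k1b := hX _ wk Xk1.
have down Z k : periodic m Z -> (a + m <= k)%N -> Z k -> Z (k - m)%N.
  by move=> perZ hk; rewrite -{1}(subnK (leq_trans (leq_addl a m) hk)) perZ.
have [h|h] := ltnP k2 (a + m)%N.
  have := hY k2 ltac:(nat_lia) Yk2.
  have [h'|h'] := ltnP k3 (a + m)%N; first by have := hX k3 ltac:(nat_lia) Xk3; nat_lia.
  have := hY _ _ (down Y k4 perY ltac:(nat_lia) Yk4); nat_lia.
have := hY _ _ (down Y k2 perY h Yk2); nat_lia.
Qed.

(* Inside the two blocks the gaps of [X] are gaps of [L], hence too short. *)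
Lemma wide_two_blocks (X : pred nat) f a1 b1 a2 b2 :
  periodic m X -> (forall k, X k -> L k) -> f <= t -> wide X f ->
  [/\ (a1 <= b1)%N, (b1 < a2)%N, (a2 <= b2)%N & (b2 < a1 + m)%N] ->
  [/\ X a1, X b1, X a2 & X b2] ->
  (forall k, (a1 <= k < a1 + m)%N -> X k -> (k <= b1)%N || (a2 <= k <= b2)%N) ->
  (forall k, (a1 <= k <= b1)%N || (a2 <= k <= b2)%N -> L k -> X k) ->
  lam - f <= pos a2 - pos b1 \/ lam - f <= pos a1 + lam - pos b2.
Proof.
move=> perX XL ft [i0 [j0 [g0 l0]]] [h1 h2 h3 h4] [Xa1 Xb1 Xa2 Xb2] blk inb.
have [i [j [wi g e]]] := gap_window a1 perX g0; rewrite -e in l0.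
case: (g) => ij Xi Xj nX.
have Xam : X (a1 + m)%N by rewrite perX.
have nolt k : X k -> (i < k)%N -> (j <= k)%N.
  by move=> Xk ik; rewrite leqNgt; apply/negP => kj; have := nX k ltac:(nat_lia); rewrite Xk.
have short u v : (u <= i)%N -> (j <= v)%N ->
    (forall k, (u <= k <= v)%N -> L k -> X k) -> False.
  move=> ui jv H.
  have : gap L i j.
    split=> //; try exact: XL.
    by move=> k hk; apply: contra (nX k hk) => Lk; apply: H => //; nat_lia.
  by move=> /gapL ?; apply: (@absurd_lt00 R); lra.
have [ib1|b1i] := ltnP i b1.
  by have hj := nolt _ Xb1 ib1; case: (short a1 b1) => // [|k hk]; [nat_lia | apply: inb; rewrite hk].
have {}b1i : i = b1 \/ (a2 <= i <= b2)%N by have := blk i ltac:(nat_lia) Xi; nat_lia.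
case: b1i => [eib|ia2].
  subst i; left.
  have hj := nolt _ Xa2 h2.
  have := pos_le hj; lra.
have [ib2|b2i] := ltnP i b2.
  have hj := nolt _ Xb2 ib2; case: (short a2 b2) => // [|k hk]; first nat_lia.
  by apply: inb; rewrite hk orbT.
have ei : i = b2 by nat_lia.
subst i; right; have hj := nolt _ Xam ltac:(nat_lia).
have := pos_le hj; rewrite posD; lra.
Qed.

(** The place [c] outside the block serves as the fourth place of a crossing, so three alternating
    places inside the block are already impossible. *)
Lemma block_order (X Y Z : pred nat) a b c :
  (a <= b)%N -> (b < c < a + m)%N -> Z c ->
  (forall k1 k2 k3 k4, (k1 < k2 < k3)%N -> (k3 < k4 < k1 + m)%N ->
     X k1 -> Y k2 || Z k2 -> X k3 -> Y k4 || Z k4 -> False) ->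
  (forall k1 k2 k3 k4, (k1 < k2 < k3)%N -> (k3 < k4 < k1 + m)%N ->
     Y k1 -> X k2 || Z k2 -> Y k3 -> X k4 || Z k4 -> False) ->
  (forall k, X k -> ~~ Y k) ->
  (forall k l, (a <= k <= b)%N -> (a <= l <= b)%N -> X k -> Y l -> (k < l)%N) \/
  (forall k l, (a <= k <= b)%N -> (a <= l <= b)%N -> X k -> Y l -> (l < k)%N).
Proof.
move=> ab bc Zc ncX ncY dXY.
have n1 k l k' : (a <= k)%N -> (k < l < k')%N -> (k' <= b)%N -> X k -> Y l -> X k' -> False.
  move=> h1 h2 h3 Xk Yl Xk'; apply: (ncX k l k' c) => //; rewrite ?Yl ?Zc ?orbT //; nat_lia.
have n2 k l k' : (a <= k)%N -> (k < l < k')%N -> (k' <= b)%N -> Y k -> X l -> Y k' -> False.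
  move=> h1 h2 h3 Xk Yl Xk'; apply: (ncY k l k' c) => //; rewrite ?Yl ?Zc ?orbT //; nat_lia.
have ne k l : X k -> Y l -> k <> l by move=> Xk Yl e; subst l; move: (dXY _ Xk); rewrite Yl.
(* A single pair with [X] before [Y] forces this order on all pairs; if there is none, the reverse
   order holds. *)
case: (boolP [exists k : 'I_b.+1, exists l : 'I_b.+1,
   [&& (a <= k)%N, (a <= l)%N, (k < l)%N, X k & Y l]]).
  case/existsP=> k /existsP [l /and5P [ak al kl Xk Yl]]; left=> p q hp hq Xp Yq.
  have := ltn_ord k; have := ltn_ord l; move=> hl hk.
  rewrite ltnNge; apply/negP => qp.
  have := ne _ _ Xp Yq; have := ne _ _ Xp Yl; have := ne _ _ Xk Yq => e1 e2 e3.
  have [h|h] := ltnP l p; first by apply: (n1 k l p) => //; nat_lia.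
  have [h'|h'] := ltnP k q; first by apply: (n1 k q p) => //; nat_lia.
  by apply: (n2 q p l) => //; nat_lia.
move/existsPn=> H; right=> p q hp hq Xp Yq.
have := ne _ _ Xp Yq => e1.
rewrite ltnNge; apply/negP => pq.
have hpb : (p < b.+1)%N by nat_lia.
have hqb : (q < b.+1)%N by nat_lia.
have /existsPn/(_ (Ordinal hqb)) := H (Ordinal hpb).
by rewrite /= Xp Yq; nat_lia.
Qed.

Lemma last_in (X : pred nat) a b i : (a <= i <= b)%N -> X i ->
  exists e, [/\ (a <= e <= b)%N, X e & forall k, (a <= k <= b)%N -> X k -> (k <= e)%N].
Proof.
move=> hi Xi; have ex : exists k, (a <= k <= b)%N && X k by exists i; rewrite hi.
have ub k : (a <= k <= b)%N && X k -> (k <= b)%N by case/andP=> /andP [].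
have [e /andP [he Xe] max] := ex_maxnP ex ub.
by exists e; split => // k hk Xk; apply: max; rewrite hk.
Qed.

Lemma first_in (X : pred nat) a b i : (a <= i <= b)%N -> X i ->
  exists e, [/\ (a <= e <= b)%N, X e & forall k, (a <= k <= b)%N -> X k -> (e <= k)%N].
Proof.
move=> hi Xi; have ex : exists k, (a <= k <= b)%N && X k by exists i; rewrite hi.
have [e /andP [he Xe] min] := ex_minnP ex.
by exists e; split => // k hk Xk; apply: min; rewrite hk.
Qed.

(* Each of [P + Q'] and [Q + P'] omits one of two long gaps, which gives four
   cases.  If both omit the same side, the total length is too small because
   [lam - t] exceeds every gap of [L]; if they omit opposite sides, the arc of
   [P + Q] (or of [P' + Q']) is counted twice, and it is at least [lam - t]. *)
Lemma ordered_blocks (P Q P' Q' : pred nat) fP fQ fP' fQ' f0 a b c d :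
  [/\ periodic m P, periodic m Q, periodic m P' & periodic m Q'] ->
  (forall k, L k = [|| P k, Q k, P' k | Q' k]) ->
  [/\ (a <= b)%N, (b < c)%N, (c <= d)%N & (d < a + m)%N] ->
  [/\ P a || Q a, P b || Q b, P' c || Q' c & P' d || Q' d] ->
  (forall k, (a <= k < a + m)%N -> P k || Q k -> (k <= b)%N) ->
  (forall k, (a <= k < a + m)%N -> P' k || Q' k -> (c <= k <= d)%N) ->
  [/\ exists k, P k, exists k, Q k, exists k, P' k & exists k, Q' k] ->
  (forall k l, (a <= k <= b)%N -> (a <= l <= b)%N -> P k -> Q l -> (k < l)%N) ->
  (forall k l, (c <= k <= d)%N -> (c <= l <= d)%N -> Q' k -> P' l -> (k < l)%N) ->
  [/\ 0 <= fP, 0 <= fQ, 0 <= fP' & 0 <= fQ'] -> 0 <= f0 ->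
  fP + fQ + fP' + fQ' + f0 <= t ->
  lam - t <= pos b - pos a <= fP + fQ -> lam - t <= pos d - pos c <= fP' + fQ' ->
  wide (fun k => P k || Q' k) (fP + f0 + fQ') ->
  wide (fun k => Q k || P' k) (fQ + f0 + fP') -> False.
Proof.
move=> [perP perQ perP' perQ'] LE [ab bc cd da] [PQa PQb PQc PQd] in1 in2
  [[iP Pi] [iQ Qi] [iP' P'i] [iQ' Q'i]] ord1 ord2 [fP0 fQ0 fP'0 fQ'0] f00 ft
  /andP[dS1 S1] /andP[dS2 S2] w1 w2.
have [jP wjP /(_ P perP)] := window_mem a iP; rewrite Pi => PjP.
have [jQ wjQ /(_ Q perQ)] := window_mem a iQ; rewrite Qi => QjQ.
have [jP' wjP' /(_ P' perP')] := window_mem a iP'; rewrite P'i => PjP'.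
have [jQ' wjQ' /(_ Q' perQ')] := window_mem a iQ'; rewrite Q'i => QjQ'.
have winP k : (a <= k < a + m)%N -> P k -> (a <= k <= b)%N.
  by move=> hk Pk; have := in1 k hk; rewrite Pk => /(_ isT); nat_lia.
have winQ k : (a <= k < a + m)%N -> Q k -> (a <= k <= b)%N.
  by move=> hk Pk; have := in1 k hk; rewrite Pk orbT => /(_ isT); nat_lia.
have winP' k : (a <= k < a + m)%N -> P' k -> (c <= k <= d)%N.
  by move=> hk Pk; have := in2 k hk; rewrite Pk => /(_ isT).
have winQ' k : (a <= k < a + m)%N -> Q' k -> (c <= k <= d)%N.
  by move=> hk Pk; have := in2 k hk; rewrite Pk orbT => /(_ isT).
have wP := winP _ wjP PjP; have wQ := winQ _ wjQ QjQ.
have wP' := winP' _ wjP' PjP'; have wQ' := winQ' _ wjQ' QjQ'.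
(* The blocks will be [P] in [[a, p1]], [Q] in [[q0, b]], [Q'] in [[c, q1]] and [P'] in
   [[p0, d]]. *)
have [p1 [hp1 Pp1 maxP]] := last_in wP PjP.
have [q0 [hq0 Qq0 minQ]] := first_in wQ QjQ.
have [q1 [hq1 Qq1 maxQ]] := last_in wQ' QjQ'.
have [p0 [hp0 Pp0 minP]] := first_in wP' PjP'.
have Pa : P a.
  case/orP: PQa => // Qa; have := ord1 _ a wP ltac:(nat_lia) PjP Qa; nat_lia.
have Qb : Q b.
  case/orP: PQb => // Pb; have := ord1 b _ ltac:(nat_lia) wQ Pb QjQ; nat_lia.
have Qc : Q' c.
  case/orP: PQc => // Pc; have := ord2 _ c wQ' ltac:(nat_lia) QjQ' Pc; nat_lia.
have Pd : P' d.
  case/orP: PQd => // Qd; have := ord2 d _ ltac:(nat_lia) wP' Qd PjP'; nat_lia.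
have pq := ord1 _ _ hp1 hq0 Pp1 Qq0; have qp := ord2 _ _ hq1 hp0 Qq1 Pp0.
have LP k : P k -> L k by rewrite LE => ->.
have LQ k : Q k -> L k by rewrite LE => ->; rewrite !orbT.
have LP' k : P' k -> L k by rewrite LE => ->; rewrite !orbT.
have LQ' k : Q' k -> L k by rewrite LE => ->; rewrite !orbT.
have ZP k : (a <= k < a + m)%N -> P k -> (k <= p1)%N.
  by move=> hk Pk; apply: maxP => //; apply: winP.
have ZQ k : (a <= k < a + m)%N -> Q k -> (q0 <= k <= b)%N.
  move=> hk Qk; have h := winQ k hk Qk; have := minQ k h Qk; nat_lia.
have ZQ' k : (a <= k < a + m)%N -> Q' k -> (c <= k <= q1)%N.
  move=> hk Qk; have h := winQ' k hk Qk; have := maxQ k h Qk; nat_lia.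
have ZP' k : (a <= k < a + m)%N -> P' k -> (p0 <= k <= d)%N.
  move=> hk Qk; have h := winP' k hk Qk; have := minP k h Qk; nat_lia.
have LZ k : (a <= k < a + m)%N -> L k ->
    (k <= p1)%N || (q0 <= k <= b)%N || ((c <= k <= q1)%N || (p0 <= k <= d)%N).
  move=> hk; rewrite LE => /or4P [/(ZP k hk)|/(ZQ k hk)|/(ZP' k hk)|/(ZQ' k hk)] ->;
  by rewrite ?orbT.
have gapLI u v : (a <= u)%N -> (u < v)%N -> (v <= a + m)%N -> L u -> L v ->
    (forall k, (u < k < v)%N -> (k <= p1)%N || (q0 <= k <= b)%N ||
       ((c <= k <= q1)%N || (p0 <= k <= d)%N) -> False) -> pos v - pos u < lam - t.
  move=> au uv va Lu Lv H; apply: gapL; split => // k hk; apply/negP => Lk.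
  by apply: (H k hk); apply: LZ => //; nat_lia.
have Lam : L (a + m)%N by apply: LP; rewrite perP.
(* The four separations between cyclically consecutive blocks are gaps of [L]. *)
have g1 := gapLI p1 q0 ltac:(nat_lia) pq ltac:(nat_lia) (LP _ Pp1) (LQ _ Qq0)
  ltac:(move=> k hk h; nat_lia).
have g2 := gapLI b c ltac:(nat_lia) bc ltac:(nat_lia) (LQ _ Qb) (LQ' _ Qc)
  ltac:(move=> k hk h; nat_lia).
have g3 := gapLI q1 p0 ltac:(nat_lia) qp ltac:(nat_lia) (LQ' _ Qq1) (LP' _ Pp0)
  ltac:(move=> k hk h; nat_lia).
have g4 := gapLI d (a + m)%N ltac:(nat_lia) ltac:(nat_lia) ltac:(nat_lia) (LP' _ Pd) Lam
  ltac:(move=> k hk h; nat_lia).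
(* The long gap of [P + Q'] passes over either [Q] or [P']; likewise that of [Q + P'] below passes
   over either [Q'] or [P]. *)
have c1 : lam - (fP + f0 + fQ') <= pos c - pos p1 \/
          lam - (fP + f0 + fQ') <= pos a + lam - pos q1.
  apply: (wide_two_blocks _ _ _ w1).
  - by move=> k; rewrite perP perQ'.
  - by move=> k /orP [/LP|/LQ'].
  - lra.
  - by split; nat_lia.
  - by rewrite Pa Pp1 Qc Qq1 !orbT.
  - by move=> k hk /orP [/(ZP k hk)|/(ZQ' k hk)] ->; rewrite ?orbT.
  - move=> k hk; have hk' : (a <= k < a + m)%N by nat_lia.
    rewrite LE => /or4P [->//|/(ZQ k hk')|/(ZP' k hk')|->]; rewrite ?orbT //; nat_lia.
have c2 : lam - (fQ + f0 + fP') <= pos p0 - pos b \/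
          lam - (fQ + f0 + fP') <= pos q0 + lam - pos d.
  apply: (wide_two_blocks _ _ _ w2).
  - by move=> k; rewrite perQ perP'.
  - by move=> k /orP [/LQ|/LP'].
  - lra.
  - by split; nat_lia.
  - by rewrite Qq0 Qb Pp0 Pd !orbT.
  (* The window now starts at [q0] and may run past [a + m]; places there are moved back by one
     period. *)
  - move=> k hk XkX; have [h|h] := ltnP k (a + m).
      have hk' : (a <= k < a + m)%N by nat_lia.
      case/orP: XkX => [/(ZQ k hk')|/(ZP' k hk')]; nat_lia.
    have hk' : (a <= k - m < a + m)%N by nat_lia.
    have e : k = (k - m + m)%N by nat_lia.
    move: XkX; rewrite e perQ perP' => /orP [/(ZQ _ hk')|/(ZP' _ hk')]; nat_lia.
  - move=> k hk; have hk' : (a <= k < a + m)%N by nat_lia.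
    rewrite LE => /or4P [/(ZP k hk')|->//|->|/(ZQ' k hk')]; rewrite ?orbT //; nat_lia.
have e := posD a; rewrite {}e in g4.
have o1 := pos_le (ltac:(nat_lia) : (a <= p1)%N).
have o2 := pos_le (ltac:(nat_lia) : (q0 <= b)%N).
have o3 := pos_le (ltac:(nat_lia) : (c <= q1)%N).
have o4 := pos_le (ltac:(nat_lia) : (p0 <= d)%N).
apply: (@absurd_lt00 R).
case: c1 => c1; case: c2 => c2; lra.
Qed.

(** Removing [k] only merges the two gaps of [L] next to it. All other gaps are shorter than
    [lam - t], so the long gap straddles [k], and it cannot pass [a] or [b], which remain in the
    set. *)
Lemma middle_bound k a b : (a < k < b)%N -> (b < a + m)%N -> L a -> L b ->
  periodic m L ->
  wide (fun i => L i && (i != k %[mod m])) t -> lam - t <= pos b - pos a.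
Proof.
move=> akb bam La Lb perL [i0 [j0 [g0 l0]]].
pose X i := L i && (i != k %[mod m]).
have perX : periodic m X by move=> i; rewrite /X perL modnDr.
have [i [j [wi g e]]] := gap_window a perX g0; rewrite -e in l0.
have nek l : (a <= l)%N -> (l < a + m)%N -> l != k -> l != k %[mod m].
  move=> h1 h2; apply: contra; have h3 : (a <= k < a + m)%N by nat_lia.
  have -> : l = (a + (l - a))%N by nat_lia.
  have -> : k = (a + (k - a))%N by nat_lia.
  by rewrite eqn_modDl !modn_small //; nat_lia.
have Xa : X a by rewrite /X La nek //; nat_lia.
have Xb : X b by rewrite /X Lb nek //; nat_lia.
have Xam : X (a + m)%N by rewrite perX.
case: (g) => ij Xi Xj nX.
have nolt l : X l -> (i < l)%N -> (j <= l)%N.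
  by move=> Xl il; rewrite leqNgt; apply/negP => lj; have := nX l ltac:(nat_lia); rewrite Xl.
have [hik|hik] := boolP ((i < k) && (k < j))%N.
  have jb := nolt _ Xb ltac:(nat_lia).
  have := pos_le jb; have := pos_le (ltac:(nat_lia) : (a <= i)%N); lra.
have /gapL : gap L i j.
  case/andP: (Xi) => Li _; case/andP: (Xj) => Lj _.
  split=> // l hl; apply: contra (nX l hl) => Ll; rewrite /X Ll /=.
  have jam := nolt _ Xam ltac:(nat_lia).
  apply: nek; try nat_lia.
  apply/eqP => lk; subst l; by rewrite hl in hik.
lra.
Qed.

End Terminals.
End CircularGaps.

(** * Connecting edge sets *)

Section Connectivity.
Variables (V E : finType) (ends : E -> V * V).
Implicit Types (F : {set E}) (A : {set V}).
Local Notation adj := (adj ends).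

Lemma adjP F x y :
  reflect (exists2 e, e \in F & ends e = (x, y) \/ ends e = (y, x)) (adj F x y).
Proof.
apply: (iffP existsP) => [[e /andP[eF /orP[]/eqP h]]|[e eF h]].
- by exists e => //; left.
- by exists e => //; right.
- by exists e; rewrite eF; case: h => ->; rewrite eqxx ?orbT.
Qed.

Lemma adj_sym F : symmetric (adj F).
Proof.
move=> x y; apply/adjP/adjP => -[e eF h]; exists e => //.
all: by case: h => h; [right | left].
Qed.

Lemma connect_adjC F : connect_sym (adj F).
Proof. exact: sym_connect_sym (@adj_sym F). Qed.

Lemma connect_adjS F F' x y : F \subset F' -> connect (adj F) x y -> connect (adj F') x y.
Proof.
move=> /subsetP sFF'; apply: connect_sub => u v /adjP [e eF h].
by apply: connect1; apply/adjP; exists e => //; apply: sFF'.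
Qed.

(** [F] may have further components, so no vertex set has to be carried along; [witness_of_conn]
    later trims [F] to a connected subgraph. *)
Definition conn F A := forall x y, x \in A -> y \in A -> connect (adj F) x y.

Definition connb F A := [forall x in A, forall y in A, connect (adj F) x y].

Lemma connP F A : reflect (conn F A) (connb F A).
Proof.
apply: (iffP forall_inP) => [h x y xA|h x xA]; first exact: (forall_inP (h x xA)).
by apply/forall_inP => y yA; apply: h.
Qed.

Lemma connS F F' A A' : F \subset F' -> A' \subset A -> conn F A -> conn F' A'.
Proof.
move=> sF /subsetP sA cF x y xA yA; apply: connect_adjS sF _.
by apply: cF; apply: sA.
Qed.

Lemma connU F F' A A' u : u \in A -> u \in A' -> conn F A -> conn F' A' ->
  conn (F :|: F') (A :|: A').
Proof.
move=> uA uA' cF cF'.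
suff cu x : x \in A :|: A' -> connect (adj (F :|: F')) u x.
  move=> x y /cu cx /cu cy; apply: connect_trans cy; by rewrite connect_adjC.
rewrite inE => /orP [] xA.
  by apply: connect_adjS (cF _ _ uA xA); apply: subsetUl.
by apply: connect_adjS (cF' _ _ uA' xA); apply: subsetUr.
Qed.

(** Testing one end is enough, since an edge of [F] connects its two ends. *)
Definition component F v := [set e in F | connect (adj F) v (ends e).1].

Lemma component_sub F v : component F v \subset F.
Proof. by apply/subsetP => e; rewrite inE => /andP []. Qed.

Lemma connect_component F v x : connect (adj F) v x -> connect (adj (component F v)) v x.
Proof.
case/connectP=> p ap ->; elim/last_ind: p ap => [|p y IH] /=; first by rewrite connect0.
rewrite rcons_path last_rcons => /andP [pp pe]; case/adjP: (pe) => e eF h.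
apply: connect_trans (IH pp) _; apply: connect1; apply/adjP; exists e => //.
have cl : connect (adj F) v (last v p) by apply/connectP; exists p.
rewrite inE eF /=; case: h => -> //=.
exact: connect_trans cl (connect1 pe).
Qed.

Lemma conn_component F A v : {in A, forall x, connect (adj F) v x} ->
  conn (component F v) (v |: A).
Proof.
move=> cA.
suff cv x : x \in v |: A -> connect (adj (component F v)) v x.
  by move=> x y /cv cx /cv cy; apply: connect_trans cy; rewrite connect_adjC.
by rewrite !inE => /orP [/eqP ->|/cA]; rewrite ?connect0 //; apply: connect_component.
Qed.

(** After its last use of [e], the walk continues from [v] or from [w] without [e]. *)
Lemma connect_setD1 F e v w x : ends e = (v, w) \/ ends e = (w, v) ->
  connect (adj F) v x -> connect (adj (F :\ e)) v x || connect (adj (F :\ e)) w x.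
Proof.
move=> ee /connectP [p ap ->].
elim/last_ind: p ap => [|p y IH] /=; first by rewrite connect0.
rewrite rcons_path last_rcons => /andP [pp /adjP [f fF h]].
have [fe|fe] := eqVneq f e.
  by subst f; case: ee h => -> [] [] *; subst; rewrite connect0 ?orbT.
have st : adj (F :\ e) (last v p) y by apply/adjP; exists f; rewrite // !inE fe.
by case/orP: (IH pp) => c; rewrite (connect_trans c (connect1 st)) ?orbT.
Qed.

(** * Splitting connecting sets at branching vertices *)

Section Length.
Variables (R : realFieldType) (l : E -> R).
Hypothesis lpos : forall e, 0 < l e.
Local Notation len := (len l).

Lemma len_ge0 F : 0 <= len F.
Proof. by apply: sumr_ge0 => e _; apply: ltW. Qed.

Lemma len0 : len set0 = 0.
Proof. by rewrite /Defs.len big_set0. Qed.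

Lemma lenD F F' : F' \subset F -> len F = len F' + len (F :\: F').
Proof.
move=> sF; rewrite /Defs.len (big_setID F') /=; congr (_ + _).
by rewrite (setIidPr sF).
Qed.

Lemma lenS F F' : F' \subset F -> len F' <= len F.
Proof. by move=> /lenD ->; rewrite lerDl len_ge0. Qed.

Lemma lenU F F' : len (F :|: F') <= len F + len F'.
Proof.
rewrite (lenD (subsetUl F F')) lerD2l; apply: lenS.
by rewrite setDUl setDv set0U subsetDl.
Qed.

Lemma len1 e : len [set e] = l e.
Proof. by rewrite /Defs.len big_set1. Qed.

Lemma lenD1 F e : e \in F -> len F = l e + len (F :\ e).
Proof. by move=> eF; rewrite (@lenD F [set e]) ?sub1set // len1. Qed.

(* The recursion behind the Dreyfus--Wagner algorithm. *)
Lemma steiner_split F A v : conn F (v |: A) -> (1 < #|A|)%N ->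
  exists u A1 A2 F0 F1 F2,
    [/\ A1 :|: A2 = A, [disjoint A1 & A2], A1 != set0 & A2 != set0] /\
    [/\ conn F0 [set v; u], conn F1 (u |: A1), conn F2 (u |: A2) &
        len F0 + len F1 + len F2 <= len F].
Proof.
move: {2}#|F| (leqnn #|F|) => n; elim: n F v => [|n IH] F v.
  rewrite leqn0 cards_eq0 => /eqP ->; move=> c0 A1.
  have eqv x : x \in A -> x = v.
    move=> xA; have := c0 x v; rewrite !inE xA eqxx !orbT => /(_ isT isT) /connectP [[|y p]] //=.
    by case/andP=> /adjP [e]; rewrite inE.
  have : A \subset [set v] by apply/subsetP => x /eqv ->; rewrite inE.
  by move/subset_leq_card; rewrite cards1; move: A1; lia.
move=> sn cF A1.
(* If the root is itself a terminal, it is split off at no cost. *)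
have [vA|vA] := boolP (v \in A).
  exists v, [set v], (A :\ v), set0, set0, F; split; split.
  - by rewrite setD1K.
  - by rewrite disjoints1 !inE eqxx.
  - by apply/set0Pn; exists v; rewrite inE.
  - by rewrite -card_gt0; have := cardsD1 v A; rewrite vA; lia.
  - by move=> x y; rewrite !inE !orbb => /eqP -> /eqP ->; rewrite connect0.
  - by move=> x y; rewrite !inE !orbb => /eqP -> /eqP ->; rewrite connect0.
  - by rewrite setD1K //; apply: connS cF; rewrite ?subsetUr.
  - by rewrite len0 !add0r.
have [a aA] : exists a, a \in A by apply/set0Pn; rewrite -card_gt0; lia.
have vU : v \in v |: A by rewrite !inE eqxx.
have /connectP [[|w p] /= pp ea] := cF v a vU (setU1r v aA).
  by rewrite ea in aA; rewrite aA in vA.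
case/andP: pp => /adjP [e eF ee] _ {p ea aA a}.
have ee' : ends e = (v, w) \/ ends e = (w, v) by [].
pose G := F :\ e.
have GF : G \subset F by apply: subsetDl.
have cG : (#|G| <= n)%N by have := cardsD1 e F; rewrite eF /G; lia.
have lG : len F = l e + len G := lenD1 eF.
have cvw x : x \in A -> connect (adj G) v x || connect (adj G) w x.
  by move=> xA; apply: (connect_setD1 ee'); apply: cF => //; apply: setU1r.
(* Here [e] is the first edge of a walk from [v] to a terminal. Without it, [B1] is still reached
   from [v], and [B2] only from [w]. *)
pose B1 := [set x in A | connect (adj G) v x]; pose B2 := A :\: B1.
have B1A : B1 \subset A by apply/subsetP => x; rewrite inE => /andP [].
have cB2 x : x \in B2 -> connect (adj G) w x /\ ~~ connect (adj G) v x.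
  rewrite !inE => /andP [] /[swap] xA; rewrite xA /= => nv; split=> //.
  by have := cvw x xA; rewrite (negbTE nv).
have le0 := ltW (lpos e).
(* Every terminal lies beyond [e]: recurse from [w] and add [e] to the stem [F0]. *)
have [B10|B1n] := eqVneq B1 set0.
  have AB2 : B2 = A by rewrite /B2 B10 setD0.
  have cA : conn (component G w) (w |: A).
    by apply: conn_component => x; rewrite -AB2 => /cB2 [].
  have sz : (#|component G w| <= n)%N by apply: leq_trans cG; apply/subset_leq_card/component_sub.
  have [u [A1' [A2' [F0 [F1 [F2 [h1 [h2 h3 h4 h5]]]]]]]] := IH _ w sz cA A1.
  exists u, A1', A2', ([set e] :|: F0), F1, F2; split => //; split=> //.
    (* Writing the set as an intersection hands [connS] the inclusion that it needs. *)
    have -> : [set v; u] = [set v; u] :&: ([set v; w] :|: [set w; u]).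
      by apply/setP => x; rewrite !inE; case: (x == v); case: (x == u); rewrite ?orbT.
    apply: connS (subxx _) (subsetIr _ _) _.
    apply: (@connU _ _ _ _ w) => //; rewrite ?inE ?eqxx ?orbT //.
    have cvw1 : connect (adj [set e]) v w by apply: connect1; apply/adjP; exists e; rewrite ?inE.
    move=> x y; rewrite !inE => /orP [] /eqP -> /orP [] /eqP ->; rewrite ?connect0 //.
    by rewrite connect_adjC.
  have := lenU [set e] F0; rewrite len1; have := lenS (component_sub G w); lra.
have [B20|B2n] := eqVneq B2 set0.
  have AB1 : B1 = A by apply/eqP; rewrite eqEsubset B1A -setD_eq0 -/B2 B20 eqxx.
  have cA : conn G (v |: A).
    apply: connS (component_sub G v) (subxx _) _.
    by apply: conn_component => x; rewrite -AB1 inE => /andP [].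
  have [u [A1' [A2' [F0 [F1 [F2 [h1 [h2 h3 h4 h5]]]]]]]] := IH _ v cG cA A1.
  by exists u, A1', A2', F0, F1, F2; split => //; split=> //; lra.
(* Both parts are nonempty, so the branching happens at [v] itself, with an empty stem. *)
exists v, B1, B2, set0, (component G v), (F :\: component G v); split; split => //.
- by rewrite /B2 -{1}(setIidPr B1A) setID.
- rewrite -setI_eq0; apply/eqP/setP => x; rewrite !inE.
  by case: (x \in A) => //=; case: connect.
- by move=> x y; rewrite !inE !orbb => /eqP -> /eqP ->; rewrite connect0.
- by apply: conn_component => x; rewrite inE => /andP [].
- have [b bB2] := set0Pn _ B2n.
  (* A common edge would let [v] reach an element of [B2] without [e]. *)
  have sub : component G w \subset F :\: component G v.
    apply/subsetP => f; rewrite !inE => /andP [/andP [fe fF] wf]; rewrite fe fF /= andbT.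
    apply/negP => vf; have [wb /negP] := cB2 b bB2; apply.
    by apply: connect_trans vf _; apply: connect_trans wb; rewrite connect_adjC.
  have eC : e \in F :\: component G v by rewrite !inE eF eqxx.
  have -> : v |: B2 = (v |: B2) :&: ([set v; w] :|: (w |: B2)).
    apply/setP => x; rewrite !inE; case: (x == v) => //=; rewrite ?orbT //= -!andbA.
    by case: connect; case: (x \in A); rewrite ?orbT ?andbF.
  apply: connS (subxx _) (subsetIr _ _) _.
  rewrite -(setUid (F :\: component G v)).
  apply: (@connU _ _ _ _ w); rewrite ?inE ?eqxx ?orbT //.
    have cvw1 : connect (adj (F :\: component G v)) v w.
      by apply: connect1; apply/adjP; exists e.
    move=> x y; rewrite !inE => /orP [] /eqP -> /orP [] /eqP ->; rewrite ?connect0 //.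
    by rewrite connect_adjC.
  apply: connS sub (subxx _) _; apply: conn_component => x /cB2 [] //.
- by rewrite len0 add0r -lenD //; apply: subset_trans (component_sub _ _) GF.
Qed.

Lemma conn_link F F' u v A : conn F [set u; v] -> conn F' (v |: A) -> conn (F :|: F') (u |: A).
Proof.
move=> cF cF'; apply: connS (subxx _) _ (connU (u := v) _ _ cF cF').
- by apply/subsetP => x; rewrite !inE => /orP [] ->; rewrite ?orbT.
- by rewrite !inE eqxx orbT.
- by rewrite !inE eqxx.
Qed.

Lemma conn_pairC F u v : conn F [set u; v] -> conn F [set v; u].
Proof. by rewrite setUC. Qed.

Lemma conn_cup F F' u A A' : conn F (u |: A) -> conn F' (u |: A') ->
  conn (F :|: F') (u |: (A :|: A')).
Proof.
move=> cF cF'; apply: connS (subxx _) _ (connU (u := u) _ _ cF cF'); rewrite ?setU11 //.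
by rewrite setUUr.
Qed.

(** Descend into the tree: while one half of [X] has more than 2 elements, the other half is moved
    to [Y]. At the end both halves have at most 2 elements, though together they have more than
    2. *)
Lemma balanced_split n A (X Y : {set V}) u FX FY :
  (#|X| <= n)%N -> (2 < #|X|)%N -> X :|: Y = A -> [disjoint X & Y] ->
  conn FX (u |: X) -> conn FY (u |: Y) ->
  exists u1 u2 P Q Y' FP FQ K FY',
    [/\ (P :|: Q) :|: Y' = A, [disjoint P & Q], [disjoint P :|: Q & Y'], P != set0 & Q != set0] /\
    [/\ (2 < #|P :|: Q|)%N, (#|P| <= 2)%N & (#|Q| <= 2)%N] /\
    [/\ conn FP (u1 |: P), conn FQ (u1 |: Q), conn K [set u1; u2], conn FY' (u2 |: Y') &
        len FP + len FQ + len K + len FY' <= len FX + len FY].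
Proof.
elim: n X Y u FX FY => [|n IH] X Y u FX FY sX X2 XYA dXY cX cY; first by lia.
have [u' [X1 [X2' [F0 [F1 [F2 [[X12 dX n1 n2] [c0 c1 c2 l012]]]]]]]] :=
  steiner_split cX (ltnW X2).
have cardX : (#|X1| + #|X2'| = #|X|)%N by rewrite -X12 cardsU (disjoint_setI0 dX) cards0 subn0.
have k1 : (0 < #|X1|)%N by rewrite card_gt0.
have k2 : (0 < #|X2'|)%N by rewrite card_gt0.
have cY' : conn (F0 :|: FY) (u' |: Y) by apply: conn_link cY; apply: conn_pairC.
have /andP [d1 d2] : [disjoint X1 & Y] && [disjoint X2' & Y].
  by move: dXY; rewrite -X12 -!setI_eq0 setIUl setU_eq0.
have l1 := lenU F0 FY.
have [h1|h1] := ltnP 2 #|X1|.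
  have [] := IH X1 (X2' :|: Y) u' F1 (F2 :|: (F0 :|: FY)) _ h1 _ _ c1 (conn_cup c2 cY').
  - by lia.
  - by rewrite setUA X12.
  - by rewrite -setI_eq0 setIUr setU_eq0 !setI_eq0 dX d1.
  move=> u1 [u2 [P [Q [Y' [FP [FQ [K [FY' [hA [hB [? ? ? ? hl]]]]]]]]]]].
  exists u1, u2, P, Q, Y', FP, FQ, K, FY'; split=> //; split=> //; split=> //.
  have := lenU F2 (F0 :|: FY); lra.
have [h2|h2] := ltnP 2 #|X2'|.
  have [] := IH X2' (X1 :|: Y) u' F2 (F1 :|: (F0 :|: FY)) _ h2 _ _ c2 (conn_cup c1 cY').
  - by lia.
  - by rewrite setUA [X2' :|: X1]setUC X12.
  - by rewrite -setI_eq0 setIUr setU_eq0 !setI_eq0 disjoint_sym dX d2.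
  move=> u1 [u2 [P [Q [Y' [FP [FQ [K [FY' [hA [hB [? ? ? ? hl]]]]]]]]]]].
  exists u1, u2, P, Q, Y', FP, FQ, K, FY'; split=> //; split=> //; split=> //.
  have := lenU F1 (F0 :|: FY); lra.
exists u', u, X1, X2', Y, F1, F2, F0, FY; split; first by rewrite X12.
split; first by rewrite X12.
by split=> //; [apply: conn_pairC | lra].
Qed.

(** The number 6 comes from here: [balanced_split] cuts off 3 or 4 elements, so of more than 6 at
    least 3 remain, and these are split once more from [u2]. *)
Lemma quartet_split F A : conn F A -> (6 < #|A|)%N ->
  exists u1 u2 P Q P' Q' FP FQ FP' FQ' K,
    [/\ (P :|: Q) :|: (P' :|: Q') = A, [disjoint P & Q], [disjoint P' & Q'] &
        [disjoint P :|: Q & P' :|: Q']] /\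
    [/\ P != set0, Q != set0, P' != set0 & Q' != set0] /\
    ((2 < #|P :|: Q|)%N /\ (2 < #|P' :|: Q'|)%N) /\
    [/\ conn FP (u1 |: P), conn FQ (u1 |: Q), conn FP' (u2 |: P') & conn FQ' (u2 |: Q')] /\
    conn K [set u1; u2] /\ len FP + len FQ + len FP' + len FQ' + len K <= len F.
Proof.
move=> cF A6; have [a aA] : exists a, a \in A by apply/set0Pn; rewrite -card_gt0; lia.
(* Any terminal may serve as the first root, with nothing on the other side. *)
have cF' : conn F (a |: A) by rewrite (setUidPr _) // sub1set.
have c0 : conn set0 (a |: set0).
  by move=> x y; rewrite !inE !orbF => /eqP -> /eqP ->; rewrite connect0.
have [] := balanced_split (leqnn #|A|) _ (setU0 A) _ cF' c0; first by lia.
  by rewrite -setI_eq0 setI0.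
move=> u1 [u2 [P [Q [Y [FP [FQ [K [FY [[hA dPQ dPQY nP nQ] [[h3 hP hQ] [cP cQ cK cY hl]]]]]]]]]]].
have cPQ : (#|P :|: Q| = #|P| + #|Q|)%N by rewrite cardsU (disjoint_setI0 dPQ) cards0 subn0.
have cA : (#|A| = #|P :|: Q| + #|Y|)%N by rewrite -hA cardsU (disjoint_setI0 dPQY) cards0 subn0.
have Y3 : (2 < #|Y|)%N by lia.
have [u3 [P' [Q' [K' [FP' [FQ' [[eY dY nP' nQ'] [cK' cP' cQ' hl']]]]]]]] :=
  steiner_split cY (ltnW Y3).
exists u1, u3, P, Q, P', Q', FP, FQ, FP', FQ', (K :|: K'); rewrite eY.
split; first by []. split; first by []. split; first by []. split; first by [].
split; first exact: conn_link cK cK'.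
have := lenU K K'; rewrite len0 in hl; lra.
Qed.

End Length.
End Connectivity.

(** * Walking around a cycle *)

Section CycleWalk.
Variables (V E : finType) (ends : E -> V * V).
Hypothesis noloop : forall e : E, (ends e).1 != (ends e).2.
Variables (VC : {set V}) (EC : {set E}).
Hypothesis Ccyc : is_cycle ends VC EC.

Definition joins (e : E) (x y : V) := ends e = (x, y) \/ ends e = (y, x).

Lemma joinsC e x y : joins e x y -> joins e y x.
Proof. by case; [right | left]. Qed.

Lemma joins_inj e x y y' : joins e x y -> joins e x y' -> y = y'.
Proof.
rewrite /joins => h h'; have := noloop e; case: h h' => -> /= [] h'.
all: by move: (congr1 fst h') (congr1 snd h') => /= e1 e2; subst; rewrite ?eqxx.
Qed.

Lemma joins_neq e x y : joins e x y -> x != y.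
Proof. by move=> h; have := noloop e; case: h => -> //=; rewrite eq_sym. Qed.

Lemma joins_ends e x y x' y' : joins e x y -> joins e x' y' -> x' = x \/ x' = y.
Proof.
rewrite /joins; case=> -> [] h'; move: (congr1 fst h') (congr1 snd h') => /= e1 e2; subst.
all: by [left | right].
Qed.

Lemma joins_incident e x y : joins e x y -> incident ends e x.
Proof. by rewrite /incident; case=> -> /=; rewrite eqxx ?orbT. Qed.

Lemma incident_joins e x : incident ends e x -> exists y, joins e x y.
Proof.
rewrite /joins /incident; case: (ends e) => a b /= /orP [] /eqP ->.
  by exists b; left.
by exists a; right.
Qed.

Lemma cycle_joins e x y : e \in EC -> joins e x y -> (x \in VC) && (y \in VC).
Proof.
move=> eEC h; case: Ccyc => _ /(_ e eEC) + _ _.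
by case: h => -> //= /andP [-> ->].
Qed.

Lemma cycle_next e x : e \in EC -> x \in VC -> incident ends e x ->
  exists f y, [/\ f \in EC, f != e & joins f x y].
Proof.
case: Ccyc => _ _ _ deg eEC xVC ex.
have := deg x xVC; rewrite (cardsD1 e) !inE eEC ex /= add1n => - [] h.
have /set0Pn [f] : [set e in EC | incident ends e x] :\ e != set0.
  by rewrite -card_gt0 h.
rewrite !inE => /and3P [fe fEC /incident_joins [y fy]].
by exists f, y.
Qed.

Lemma cycle_deg2 e f g x : [/\ e \in EC, f \in EC & g \in EC] -> x \in VC ->
  [/\ incident ends e x, incident ends f x & incident ends g x] ->
  e != f -> g = e \/ g = f.
Proof.
case: Ccyc => _ _ _ deg [eEC fEC gEC] xVC [ex fx gx] ef.
have [->|ge] := eqVneq g e; first by left.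
have [->|gf] := eqVneq g f; first by right.
have : g |: [set e; f] \subset [set h in EC | incident ends h x].
  by apply/subsetP => h; rewrite !inE => /or3P [] /eqP ->; apply/andP.
move/subset_leq_card; rewrite deg // cardsU1 cards2 !inE ef negb_or ge gf.
by [].
Qed.

Definition other (e : E) (x : V) : V := if (ends e).1 == x then (ends e).2 else (ends e).1.

Lemma joins_other e x : incident ends e x -> joins e x (other e x).
Proof.
rewrite /joins /incident /other; case: (ends e) => a b /=.
by have [->|] := eqVneq a x; [left | move=> _ /= /eqP ->; right].
Qed.

(** A state is a vertex with the edge by which it is left. Keeping the edge makes cycles of length
    two work. By [walk_stepP] the default [d.2] does not occur on states of the cycle. *)
Definition walk_step (d : V * E) : V * E :=
  let y := other d.2 d.1 in
  (y, odflt d.2 [pick f in EC | incident ends f y && (f != d.2)]).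

Lemma walk_stepP d : d.2 \in EC -> incident ends d.2 d.1 ->
  [/\ joins d.2 d.1 (walk_step d).1, (walk_step d).2 \in EC,
      incident ends (walk_step d).2 (walk_step d).1 & (walk_step d).2 != d.2].
Proof.
case: d => x e /= eEC ex.
have jo := joins_other ex.
case: pickP => [f /and3P [fEC fy fe] | no] /=; first by [].
have /andP [_ yVC] := cycle_joins eEC jo.
have [f [z [fEC fe jf]]] := cycle_next eEC yVC (joins_incident (joinsC jo)).
by have := no f; rewrite /= fEC fe (joins_incident jf).
Qed.

(** Iterate [walk_step] until a vertex repeats. Degree 2 makes the first repetition a return to the
    initial state, which gives the period; connectedness shows that everything is visited. *)
Lemma cycle_parametrization : exists (m : nat) (c : nat -> V) (ed : nat -> E),
  [/\ (0 < m)%N, forall i, c (i + m)%N = c i & forall i, ed (i + m)%N = ed i] /\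
  [/\ forall i j, (i < m)%N -> (j < m)%N -> c i = c j -> i = j,
      forall i j, (i < m)%N -> (j < m)%N -> ed i = ed j -> i = j &
      forall i, joins (ed i) (c i) (c i.+1)] /\
  [/\ forall v, v \in VC -> exists i, v = c i, forall i, ed i \in EC &
      forall e, e \in EC -> exists i, e = ed i].
Proof.
case: (Ccyc) => /set0Pn [v0 v0VC] _ conC deg.
have /set0Pn [e0] : [set e in EC | incident ends e v0] != set0.
  by rewrite -card_gt0 deg.
rewrite inE => /andP [e0EC e0v0].
pose D i := iter i walk_step (v0, e0).
pose c i := (D i).1; pose ed i := (D i).2.
have inv i : ed i \in EC /\ incident ends (ed i) (c i).
  by elim: i => [//|i [h1 h2]]; case: (walk_stepP h1 h2).
have stp i : joins (ed i) (c i) (c i.+1) /\ ed i.+1 != ed i.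
  by have [h1 h2] := inv i; case: (walk_stepP h1 h2).
have edEC i : ed i \in EC by case: (inv i).
have jn i : joins (ed i) (c i) (c i.+1) by case: (stp i).
have ne i : ed i.+1 != ed i by case: (stp i).
have cVC i : c i \in VC by case/andP: (cycle_joins (edEC i) (jn i)).
have two i g : g \in EC -> incident ends g (c i.+1) -> g = ed i \/ g = ed i.+1.
  move=> gEC gi; apply: (@cycle_deg2 _ _ _ (c i.+1)) => //.
    by split=> //; [apply: joins_incident (joinsC (jn i)) | apply: joins_incident (jn _)].
  by rewrite eq_sym.
have ex : exists j, [exists i : 'I_j, c i == c j].
  pose f (i : 'I_#|V|.+1) := c i.
  have /injectivePn [i [j ij fij]] : ~~ injectiveb f.
    apply/negP => /injectiveP /leq_card; by rewrite card_ord ltnn.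
  have [h|h|h] := ltngtP i j.
  - by exists j; apply/existsP; exists (Ordinal h); rewrite /= -/(f i) fij.
  - by exists i; apply/existsP; exists (Ordinal h); rewrite /= -/(f j) -fij.
  - by rewrite (ord_inj h) eqxx in ij.
have [m /existsP [[j jm] /= /eqP cjm] minm] := ex_minnP ex.
have cinj' i k : (i < k)%N -> (k < m)%N -> c i <> c k.
  move=> ik km e; have : (m <= k)%N.
    by apply: minm; apply/existsP; exists (Ordinal ik); rewrite /= e.
  by rewrite leqNgt km.
have cinj i k : (i < m)%N -> (k < m)%N -> c i = c k -> i = k.
  move=> im km e; have [h|h|//] := ltngtP i k; first by case: (cinj' _ _ h km).
  by case: (cinj' _ _ h im).
have m0 : (0 < m)%N by apply: leq_ltn_trans jm.
have em : m = m.-1.+1 by rewrite prednK.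
have jl := jn m.-1; rewrite -em in jl.
have nb k : ed m.-1 = ed k -> c m = c k -> c m.-1 = c k.+1.
  move=> e1 e2; apply: (joins_inj (joinsC jl)).
  by rewrite e1 e2; apply: jn.
(* A return to [c j] with [j > 0] would use one of the two edges already known at [c j]; this forces
   an earlier repeated vertex, a repeated consecutive edge or a loop. *)
have j0 : j = 0%N.
  case: (posnP j) => // jp; have ej : j = j.-1.+1 by rewrite prednK.
  have := two j.-1 (ed m.-1) (edEC _); rewrite -ej cjm.
  case=> [|e1|e1]; first exact: joins_incident (joinsC jl).
    have e2 : c m.-1 = c j.-1.
      apply: (joins_inj (joinsC jl)); rewrite e1 -cjm {2}ej; apply: joinsC; exact: jn.
    have := cinj m.-1 j.-1 ltac:(lia) ltac:(lia) e2; lia.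
  have e2 := nb j e1 (esym cjm).
  have [h|h] := ltnP j.+1 m.
    have e3 := cinj m.-1 j.+1 ltac:(lia) h e2.
    by have := ne j; rewrite -e3 e1 eqxx.
  have e3 : m.-1 = j by lia.
  by have := joins_neq (jn j); rewrite -{1}e3 e2 eqxx.
subst j.
have nl : ed m.-1 != ed 0%N.
  apply/eqP => e1; have e2 := nb 0%N e1 (esym cjm).
  have [h|h] := ltnP 1 m.
    have e3 := cinj m.-1 1%N ltac:(lia) h e2.
    by have := ne 0%N; rewrite -e3 e1 eqxx.
  have e3 : m.-1 = 0%N by lia.
  by have := joins_neq (jn 0%N); rewrite -{1}e3 e2 eqxx.
have edm : ed m = ed 0%N.
  have := two m.-1 (ed 0%N) (edEC _); rewrite -em -cjm.
  case=> [|e1|//]; first exact: joins_incident (jn 0%N).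
  by rewrite e1 eqxx in nl.
have Dm : D m = D 0%N.
  by rewrite [LHS]surjective_pairing [RHS]surjective_pairing -/(c m) -/(ed m) edm -cjm.
have Dper i : D (i + m)%N = D i by rewrite /D iterD -/(D m) Dm.
exists m, c, ed; split; first by split=> // i; rewrite /c /ed Dper.
have edinj i k : (i < k)%N -> (k < m)%N -> ed i <> ed k.
  move=> ik km e; have jk := jn k; rewrite -e in jk.
  case: (joins_ends (jn i) jk) => e'.
    by case: (cinj' _ _ ik km).
  have e2 := cinj k i.+1 km (leq_ltn_trans ik km) e'.
  by have := ne i; rewrite -e2 e eqxx.
split.
  split=> // i k im km e; have [h|h|//] := ltngtP i k; first by case: (edinj _ _ h km).
  by case: (edinj _ _ h im).
have at_c g i : g \in EC -> incident ends g (c i) -> exists2 k, g = ed k & c i = c k \/ c i = c k.+1.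
  (* Adding [m] provides a predecessor even when [i = 0]. *)
  move=> gEC gi; have ei : (i + m)%N = (i + m).-1.+1 by lia.
  have ci : c i = c (i + m)%N by rewrite /c Dper.
  have := two (i + m).-1 g gEC; rewrite -ei -ci => /(_ gi) [] ->.
    by exists (i + m).-1 => //; right; rewrite -ei.
  by exists (i + m)%N => //; left.
have cov v : v \in VC -> exists i, v = c i.
  move=> vVC; have /connectP [p pp ->] := conC v0 v v0VC vVC.
  elim/last_ind: p pp => [_|p y IH] /=; first by exists 0%N.
  rewrite rcons_path last_rcons => /andP [/IH [i ->]] /adjP [g gEC jg].
  have [k ek ck] := at_c g i gEC (joins_incident jg).
  rewrite ek in jg; case: ck => ck.
    by exists k.+1; apply: (joins_inj jg); rewrite ck.
  by exists k; apply: (joins_inj jg); rewrite ck; apply: joinsC.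
split=> // g gEC.
have /andP [/cov [i ei] _] : ((ends g).1 \in VC) && ((ends g).2 \in VC) by case: Ccyc => _ + _ _; apply.
have [k ->] := at_c g i gEC ltac:(by rewrite /incident ei eqxx); by exists k.
Qed.

End CycleWalk.

(** * Steiner distance on the cycle *)

Lemma wide_ext (R : realFieldType) (pos : nat -> R) lam (X Y : pred nat) f g :
  X =1 Y -> f <= g -> wide pos lam X f -> wide pos lam Y g.
Proof.
move=> XY fg [i [j [[ij Xi Xj nX] h]]]; exists i, j; split; last lra.
by split; rewrite -?XY // => k hk; rewrite -XY nX.
Qed.

Lemma disjoint_setU (T : finType) (A B C : {set T}) :
  [disjoint A & B :|: C] = [disjoint A & B] && [disjoint A & C].
Proof. by rewrite -!setI_eq0 setIUr setU_eq0. Qed.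

Lemma disjoint_setUl (T : finType) (A B C : {set T}) :
  [disjoint A :|: B & C] = [disjoint A & C] && [disjoint B & C].
Proof. by rewrite -!setI_eq0 setIUl setU_eq0. Qed.

Lemma periodic_modn (T : Type) m (f : nat -> T) : (forall i, f (i + m)%N = f i) ->
  forall k, f k = f (k %% m)%N.
Proof.
move=> per k; rewrite {1}(divn_eq k m); elim: (k %/ m)%N => [|q IH]; first by rewrite mul0n.
by rewrite mulSn -addnA addnC per.
Qed.

Lemma periodic_inj (T : Type) m (f : nat -> T) : (0 < m)%N ->
  (forall i, f (i + m)%N = f i) ->
  (forall i j, (i < m)%N -> (j < m)%N -> f i = f j -> i = j) ->
  forall i j, f i = f j -> i = j %[mod m].
Proof.
move=> m0 per inj i j.
rewrite (periodic_modn per i) (periodic_modn per j) => /inj.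
by rewrite !ltn_mod => /(_ m0 m0).
Qed.

Lemma eqmod_window m w i j : (w <= i < w + m)%N -> (w <= j < w + m)%N ->
  i = j %[mod m] -> i = j.
Proof.
move=> hi hj /eqP.
have -> : i = (w + (i - w))%N by lia.
have -> : j = (w + (j - w))%N by lia.
by rewrite eqn_modDl !modn_small; [move/eqP->|lia|lia].
Qed.

Section CycleLength.
Variables (V E : finType) (ends : E -> V * V).
Hypothesis noloop : forall e : E, (ends e).1 != (ends e).2.
Variables (R : realFieldType) (l : E -> R).
Hypothesis lpos : forall e : E, 0 < l e.
Variables (VC : {set V}) (EC : {set E}).
Variables (m : nat) (c : nat -> V) (ed : nat -> E).
Hypothesis m_gt0 : (0 < m)%N.
Hypothesis c_per : forall i, c (i + m)%N = c i.
Hypothesis ed_per : forall i, ed (i + m)%N = ed i.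
Hypothesis c_inj : forall i j, (i < m)%N -> (j < m)%N -> c i = c j -> i = j.
Hypothesis ed_inj : forall i j, (i < m)%N -> (j < m)%N -> ed i = ed j -> i = j.
Hypothesis ed_joins : forall i, joins ends (ed i) (c i) (c i.+1).
Hypothesis c_cover : forall v, v \in VC -> exists i, v = c i.
Hypothesis ed_EC : forall i, ed i \in EC.
Hypothesis ed_cover : forall e, e \in EC -> exists i, e = ed i.
Local Notation conn := (conn ends).
Local Notation len := (len l).

Definition pos (k : nat) : R := \sum_(0 <= i < k) l (ed i).
Local Notation lam := (pos m).
Definition at_pos (B : {set V}) : pred nat := fun k => c k \in B.

Lemma pos_le : {homo pos : i j / (i <= j)%N >-> i <= j}.
Proof.
apply: (homo_leq (@lexx _ _) (fun y x z => @le_trans _ _ y x z)) => i.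
by rewrite /pos big_nat_recr //= lerDl ltW.
Qed.

Lemma posD i : pos (i + m)%N = pos i + lam.
Proof.
elim: i => [|i IH]; first by rewrite add0n {2}/pos big_geq // add0r.
by rewrite addSn /pos !big_nat_recr //= -!/(pos _) IH ed_per addrAC.
Qed.

Lemma at_pos_periodic B : periodic m (at_pos B).
Proof. by move=> k; rewrite /at_pos c_per. Qed.

Lemma window_c w v : v \in VC -> exists2 r, (w <= r < w + m)%N & v = c r.
Proof.
move=> /c_cover [i ei].
have [r wr /(_ (at_pos [set v]) (at_pos_periodic _))] := window_mem m_gt0 w i.
by rewrite /at_pos -ei !inE eqxx => /eqP er; exists r.
Qed.

Lemma c_window w i j : (w <= i < w + m)%N -> (w <= j < w + m)%N -> c i = c j -> i = j.
Proof. by move=> hi hj /(periodic_inj m_gt0 c_per c_inj); apply: eqmod_window hi hj. Qed.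

Definition arc i j : {set E} := [set e | e \in [seq ed k | k <- index_iota i j]].

Lemma arc_len i j : (i <= j <= i + m)%N -> len (arc i j) = pos j - pos i.
Proof.
move=> hij; rewrite /Defs.len /arc (eq_bigl (mem [seq ed k | k <- index_iota i j])); last first.
  by move=> e; rewrite inE.
rewrite -big_uniq /=; last first.
  rewrite map_inj_in_uniq ?iota_uniq // => x y; rewrite !mem_index_iota => hx hy.
  by move/(periodic_inj m_gt0 ed_per ed_inj); apply: (@eqmod_window _ i); lia.
rewrite big_map /pos (@big_cat_nat _ _ _ i 0 j) //=; [rewrite addrC addrK // | lia].
Qed.

Lemma arcP i j e : reflect (exists2 k, (i <= k < j)%N & e = ed k) (e \in arc i j).
Proof.
rewrite inE; apply: (iffP mapP) => -[k h ->]; exists k => //; move: h; by rewrite mem_index_iota.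
Qed.

Lemma connect_arc i j k : (i <= k <= j)%N -> connect (adj ends (arc i j)) (c i) (c k).
Proof.
elim: k => [|k IH] hk; first by have -> : i = 0%N by lia.
have [->|ne] := eqVneq i k.+1; first exact: connect0.
apply: connect_trans (IH ltac:(lia)) _; apply: connect1; apply/adjP; exists (ed k).
  by apply/arcP; exists k => //; lia.
exact: ed_joins.
Qed.

(** The complementary arc, from [j] to the next copy [i + m] of [i], passes through all of [B]. *)
Lemma conn_of_gap (B : {set V}) i j : B \subset VC -> gap (at_pos B) i j ->
  exists2 S : {set E}, S \subset EC & conn S B /\ len S = lam - (pos j - pos i).
Proof.
move=> /subsetP sB g; have bd := gap_bound m_gt0 (@at_pos_periodic B) g.
case: g => ij Bi Bj nB.
exists (arc j (i + m)); first by apply/subsetP => e /arcP [k _ ->].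
split; last by rewrite arc_len ?posD; [lra | lia].
suff cj x : x \in B -> connect (adj ends (arc j (i + m))) (c j) x.
  by move=> x y /cj cx /cj cy; apply: connect_trans cy; rewrite connect_adjC.
move=> xB; have [r wr ex] := window_c i.+1 (sB _ xB).
rewrite ex; apply: connect_arc.
have : (j <= r)%N.
  rewrite leqNgt; apply/negP => rj; have := nB r ltac:(lia); by rewrite /at_pos -ex xB.
lia.
Qed.

(** An edge missing from [S] lies in a gap of [B], and [S] contains the whole complementary arc: a
    second missing edge there would separate the ends of the gap. If [S] is all of [EC], any edge
    can be used to choose the gap. *)
Lemma wide_of_conn (B : {set V}) (S : {set E}) : B \subset VC -> B != set0 ->
  S \subset EC -> conn S B -> wide pos lam (at_pos B) (len S).
Proof.
move=> /subsetP sB /set0Pn [b bB] sS cS.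
have [s miss] : exists s, ed s \notin S \/ S = EC.
  have [e|h] := set_0Vmem (EC :\: S).
    by exists 0%N; right; apply/eqP; rewrite eqEsubset sS -setD_eq0 e eqxx.
  case: h => e; rewrite inE => /andP [eS /ed_cover [s es]].
  by exists s; left; rewrite -es.
(* Passing to the next copy of [s] leaves a full period before it, in which an element of [B] can be
   found. *)
have {miss} miss : ed (s + m)%N \notin S \/ S = EC by rewrite ed_per.
have [r1 w1 e1] := window_c s.+1 (sB _ bB).
have [r2 w2 e2] := window_c (s + m).+1 (sB _ bB).
have {}w1 : (r1 <= s + m)%N by nat_lia.
move: (s + m)%N miss w1 w2 => {}s miss w1 w2.
have B1 : at_pos B r1 by rewrite /at_pos -e1.
have B2 : at_pos B r2 by rewrite /at_pos -e2.
have [i [hi Bi maxi]] := @last_in (at_pos B) 0 s r1 ltac:(nat_lia) B1.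
have [j [hj Bj minj]] := @first_in (at_pos B) s.+1 (s + m) r2 ltac:(nat_lia) B2.
have g : gap (at_pos B) i j.
  split=> //; first nat_lia.
  move=> k hk; apply/negP => Bk; have [ks|ks] := leqP k s.
    have := maxi k ltac:(nat_lia) Bk; nat_lia.
  have := minj k ltac:(nat_lia) Bk; nat_lia.
have bd := gap_bound m_gt0 (@at_pos_periodic B) g.
exists i, j; split=> //.
suff sub : arc j (i + m) \subset S.
  have := lenS lpos sub; rewrite arc_len ?posD; last by nat_lia.
  lra.
case: miss => [miss|->]; last by apply/subsetP => e /arcP [k _ ->].
apply/subsetP => e /arcP [k hk ->]; apply/negPn/negP => kS.
(* With [ed s] and [ed k] both missing, a walk in [S] from [c j] is confined to the places [s + 1]
   to [k]. *)
have reach x : connect (adj ends S) (c j) x -> exists2 r, (s < r <= k)%N & x = c r.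
  case/connectP=> p pp ->; elim/last_ind: p pp => [_|p y IH] /=; first by exists j => //; nat_lia.
  rewrite rcons_path last_rcons => /andP [/IH [r hr er]] /adjP [f fS jf].
  rewrite er in jf => {IH er}.
  have [r0 er0] := ed_cover (subsetP sS f fS).
  have [r' [q [q' [wr' eqr]]]] := window_shift m_gt0 s r0.
  have fr' : f = ed r'.
    rewrite er0 (periodic_modn ed_per r0) (periodic_modn ed_per r').
    by rewrite -(modnMDl q r0) addnC eqr addnC modnMDl.
  rewrite fr' in fS jf; have r's : r' <> s by move=> e'; rewrite -e' fS in miss.
  have r'k : r' <> k by move=> e'; rewrite -e' fS in kS.
  case: (joins_ends (ed_joins r') jf) => ecr.
    have err : r = r' by apply: (@c_window s.+1) ecr; nat_lia.
    subst r; exists r'.+1; first nat_lia.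
    exact: joins_inj noloop _ _ _ _ jf (ed_joins r').
  have err : r = r'.+1 by apply: (@c_window s.+1) ecr; nat_lia.
  subst r; exists r'; first nat_lia.
  exact: joins_inj noloop _ _ _ _ jf (joinsC (ed_joins r')).
have [r hr er] := reach _ (cS _ _ Bj Bi).
have := @c_window i i r ltac:(nat_lia) ltac:(nat_lia) er; nat_lia.
Qed.

Lemma c_eqmod i j : (c i == c j) = (i == j %[mod m]).
Proof.
apply/eqP/eqP => [/(periodic_inj m_gt0 c_per c_inj) //|].
by rewrite (periodic_modn c_per i) (periodic_modn c_per j) => ->.
Qed.

(** The comparison of Steiner distances in edge-set form: the cycle joins [A] as cheaply as any edge
    set of the whole graph. *)
Definition replaceable (A : {set V}) :=
  forall F, conn F A -> exists S : {set E}, [/\ S \subset EC, conn S A & len S <= len F].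

(** * A minimal set of terminals on which the cycle is too long *)

Section MinimalCounterexample.
Variables (A : {set V}) (F : {set E}).
Hypothesis A_VC : A \subset VC.
Hypothesis A_gt6 : (6 < #|A|)%N.
Hypothesis IH : forall B : {set V}, B \proper A -> replaceable B.
Hypothesis cFA : conn F A.
Hypothesis bad : forall S : {set E}, S \subset EC -> conn S A -> len F < len S.
Hypothesis cEC : conn EC A.

Lemma counterexample_wide (B : {set V}) F' f :
  B \proper A -> B != set0 -> conn F' B -> len F' <= f -> wide pos lam (at_pos B) f.
Proof.
move=> pB B0 cB lf; have [S [sS cS lS]] := IH pB cB.
apply: wide_ext (frefl _) _ (wide_of_conn _ B0 sS cS); first lra.
exact: subset_trans (proper_sub pB) A_VC.
Qed.

Lemma counterexample_gap i j : gap (at_pos A) i j -> pos j - pos i < lam - len F.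
Proof. by move=> g; have [S sS [cS lS]] := conn_of_gap A_VC g; have := bad sS cS; lra. Qed.

Lemma counterexample_lt : len F < lam.
Proof.
have A0 : A != set0 by rewrite -card_gt0; apply: leq_trans A_gt6.
have [i [j [g _]]] := wide_of_conn A_VC A0 (subxx EC) cEC.
have := counterexample_gap g; case: g => ij _ _ _.
have := pos_le (ltnW ij); lra.
Qed.

(** With 3 elements, [B] has one strictly between its extremes. Removing it from [A] leaves a proper
    subset, which by minimality has a gap of length at least [lam - len F], and [middle_bound]
    applies. *)
Lemma counterexample_middle (B : {set V}) a b : B \subset A -> (2 < #|B|)%N ->
  at_pos B a -> at_pos B b -> (b < a + m)%N ->
  (forall k, (a <= k < a + m)%N -> at_pos B k -> (k <= b)%N) ->
  lam - len F <= pos b - pos a.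
Proof.
move=> sB B3 Ba Bb bam hB.
have /set0Pn [v] : B :\ c a :\ c b != set0.
  rewrite -card_gt0; have := cardsD1 (c a) B; have := cardsD1 (c b) (B :\ c a).
  by move: B3; case: (c a \in B); case: (c b \in _) => /=; lia.
rewrite !inE => /and3P [vb va vB].
have vA := subsetP sB _ vB.
have [k hk ek] := window_c a (subsetP A_VC _ vA).
have kb : (k <= b)%N by apply: hB => //; rewrite /at_pos -ek.
have ka : k <> a by move=> e; rewrite ek e eqxx in va.
have kb' : k <> b by move=> e; rewrite ek e eqxx in vb.
apply: (middle_bound m_gt0 pos_le posD counterexample_gap (k := k)) => //.
- by nat_lia.
- exact: (subsetP sB).
- exact: (subsetP sB).
- exact: at_pos_periodic.
apply: (@wide_ext _ _ _ (at_pos (A :\ v)) _ (len F)) => //.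
  by move=> i; rewrite /at_pos !inE ek c_eqmod andbC.
apply: (counterexample_wide (F' := F)) => //.
- by rewrite properD1.
- by rewrite -card_gt0; have := cardsD1 v A; rewrite vA; move: A_gt6; lia.
- by apply: connS cFA => //; apply: subD1set.
Qed.

Lemma cover_proper (B B' : {set V}) : B :|: B' = A -> [disjoint B & B'] -> B' != set0 ->
  B \proper A.
Proof.
move=> e d /set0Pn [x xB']; rewrite -e; apply/properP; split; first exact: subsetUl.
by exists x; rewrite ?inE ?xB' ?orbT //; rewrite (disjointFl d).
Qed.

Section Bipartition.
Variables (X Y : {set V}) (FX FY : {set E}) (fX fY : R).
Hypotheses (XY : X :|: Y = A) (dXY : [disjoint X & Y]) (X0 : X != set0) (Y0 : Y != set0).
Hypotheses (cX : conn FX X) (cY : conn FY Y) (lX : len FX <= fX) (lY : len FY <= fY).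
Hypothesis lXY : fX + fY <= len F.

Let wX : wide pos lam (at_pos X) fX.
Proof. exact: counterexample_wide (cover_proper XY dXY Y0) X0 cX lX. Qed.

Let wY : wide pos lam (at_pos Y) fY.
Proof.
apply: counterexample_wide Y0 cY lY; apply: cover_proper X0; first by rewrite setUC.
by rewrite disjoint_sym.
Qed.

Let disj k : at_pos X k -> ~~ at_pos Y k.
Proof. by rewrite /at_pos => xX; rewrite (disjointFr dXY). Qed.

Let cov k : at_pos A k = at_pos X k || at_pos Y k.
Proof. by rewrite /at_pos -XY inE. Qed.

Definition counterexample_split := split_arcs m_gt0 pos_le posD counterexample_lt
  counterexample_gap (@at_pos_periodic X) (@at_pos_periodic Y) disj cov wX wY lXY.

Definition counterexample_noncrossing := noncrossing m_gt0 pos_le posD counterexample_lt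
  counterexample_gap (@at_pos_periodic X) (@at_pos_periodic Y) disj cov wX wY lXY.

End Bipartition.

(** The configuration of [quartet_split] without the size bounds; the symmetries below reduce all
    cyclic orders to one. *)
Definition quartet (u1 u2 : V) (P Q P' Q' : {set V}) (FP FQ FP' FQ' K : {set E}) : Prop :=
    [/\ (P :|: Q) :|: (P' :|: Q') = A, [disjoint P & Q], [disjoint P' & Q'] &
        [disjoint P :|: Q & P' :|: Q']] /\
    [/\ P != set0, Q != set0, P' != set0 & Q' != set0] /\
    [/\ conn FP (u1 |: P), conn FQ (u1 |: Q), conn FP' (u2 |: P') & conn FQ' (u2 |: Q')] /\
    conn K [set u1; u2] /\ len FP + len FQ + len FP' + len FQ' + len K <= len F.

Lemma quartet_swapl u1 u2 P Q P' Q' FP FQ FP' FQ' K :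
  quartet u1 u2 P Q P' Q' FP FQ FP' FQ' K -> quartet u1 u2 Q P P' Q' FQ FP FP' FQ' K.
Proof.
move=> [[h1 h2 h3 h4] [[? ? ? ?] [[? ? ? ?] [? ?]]]].
split; first by rewrite [Q :|: P]setUC [[disjoint Q & P]]disjoint_sym.
by do 3![split=> //]; lra.
Qed.

Lemma quartet_swap u1 u2 P Q P' Q' FP FQ FP' FQ' K :
  quartet u1 u2 P Q P' Q' FP FQ FP' FQ' K -> quartet u2 u1 P' Q' P Q FP' FQ' FP FQ K.
Proof.
move=> [[h1 h2 h3 h4] [[? ? ? ?] [[? ? ? ?] [cK ?]]]].
split; first by split=> //; [rewrite setUC | rewrite disjoint_sym].
do 2![split=> //]; split; first exact: conn_pairC.
lra.
Qed.

Lemma quartet_swapr u1 u2 P Q P' Q' FP FQ FP' FQ' K :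
  quartet u1 u2 P Q P' Q' FP FQ FP' FQ' K -> quartet u1 u2 P Q Q' P' FP FQ FQ' FP' K.
Proof. by move=> /quartet_swap/quartet_swapl/quartet_swap. Qed.

(** The pieces other than [FP] join [Q], [P'] and [Q'] through the link [K], so [P] and the rest
    form a bipartition realised within the length of [F]. *)
Lemma quartet_noncrossing u1 u2 P Q P' Q' FP FQ FP' FQ' K :
  quartet u1 u2 P Q P' Q' FP FQ FP' FQ' K ->
  forall k1 k2 k3 k4, (k1 < k2 < k3)%N -> (k3 < k4 < k1 + m)%N ->
    at_pos P k1 -> at_pos Q k2 || at_pos (P' :|: Q') k2 -> at_pos P k3 ->
    at_pos Q k4 || at_pos (P' :|: Q') k4 -> False.
Proof.
move=> [[h1 h2 h3 h4] [[nP nQ nP' nQ'] [[cP cQ cP' cQ'] [cK hl]]]] k1 k2 k3 k4 h12 h34.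
have cR := conn_cup cQ (conn_link cK (conn_cup cP' cQ')).
rewrite /at_pos -!in_setU.
have lR1 := lenU lpos FQ (K :|: (FP' :|: FQ')).
have lR2 := lenU lpos K (FP' :|: FQ').
have lR3 := lenU lpos FP' FQ'.
apply: (@counterexample_noncrossing P (Q :|: (P' :|: Q')) FP (FQ :|: (K :|: (FP' :|: FQ')))
  (len FP) (len FQ + len K + len FP' + len FQ')) => //.
- by rewrite setUA.
- by rewrite disjoint_setU h2 (disjointWl (subsetUl P Q) h4).
- by case/set0Pn: nQ => x xQ; apply/set0Pn; exists x; rewrite inE xQ.
- by apply: connS cP => //; apply: subsetUr.
- by apply: connS cR => //; apply: subsetUr.
- lra.
- lra.
Qed.

(** The mixed pair is joined through the link [K], and it is a proper subset of [A] because [Q] is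
    nonempty. *)
Lemma quartet_wide u1 u2 P Q P' Q' FP FQ FP' FQ' K :
  quartet u1 u2 P Q P' Q' FP FQ FP' FQ' K ->
  wide pos lam (fun k => at_pos P k || at_pos Q' k) (len FP + len K + len FQ').
Proof.
move=> [[h1 h2 h3 h4] [[nP nQ nP' nQ'] [[cP cQ cP' cQ'] [cK hl]]]].
have cR := conn_cup cP (conn_link cK cQ').
have lR1 := lenU lpos FP (K :|: FQ').
have lR2 := lenU lpos K FQ'.
apply: (@wide_ext _ _ _ (at_pos (P :|: Q')) _ (len FP + len K + len FQ')) => //.
  by move=> k; rewrite /at_pos inE.
apply: (@counterexample_wide _ (FP :|: (K :|: FQ'))).
- apply: (@cover_proper _ (Q :|: P')).
  + by rewrite -h1 setUACA [Q' :|: P']setUC.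
  + move: h4; rewrite !disjoint_setUl !disjoint_setU => /andP [/andP [-> _] /andP [_ h4]].
    by rewrite h2 [[disjoint Q' & Q]]disjoint_sym h4 disjoint_sym.
  + by case/set0Pn: nQ => x xQ; apply/set0Pn; exists x; rewrite inE xQ.
- by case/set0Pn: nP => x xQ; apply/set0Pn; exists x; rewrite inE xQ.
- by apply: connS cR => //; apply: subsetUr.
- lra.
Qed.

Lemma quartet_order u1 u2 P Q P' Q' FP FQ FP' FQ' K a b r :
  quartet u1 u2 P Q P' Q' FP FQ FP' FQ' K ->
  (a <= b)%N -> (b < r < a + m)%N -> at_pos (P' :|: Q') r ->
  (forall k l, (a <= k <= b)%N -> (a <= l <= b)%N -> at_pos P k -> at_pos Q l -> (k < l)%N) \/
  (forall k l, (a <= k <= b)%N -> (a <= l <= b)%N -> at_pos P k -> at_pos Q l -> (l < k)%N).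
Proof.
move=> qt ab br Zr.
apply: (block_order m_gt0 ab br Zr (quartet_noncrossing qt)
  (quartet_noncrossing (quartet_swapl qt))).
case: qt => -[_ dPQ _ _] _ k; rewrite /at_pos => kP; by rewrite (disjointFr dPQ).
Qed.

Lemma quartet_ordered u1 u2 P Q P' Q' FP FQ FP' FQ' K a b r s :
  quartet u1 u2 P Q P' Q' FP FQ FP' FQ' K ->
  [/\ (a <= b)%N, (b < r)%N, (r <= s)%N & (s < a + m)%N] ->
  [/\ at_pos (P :|: Q) a, at_pos (P :|: Q) b, at_pos (P' :|: Q') r & at_pos (P' :|: Q') s] ->
  (forall k, (a <= k < a + m)%N -> at_pos (P :|: Q) k -> (k <= b)%N) ->
  (forall k, (a <= k < a + m)%N -> at_pos (P' :|: Q') k -> (r <= k <= s)%N) ->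
  lam - len F <= pos b - pos a <= len FP + len FQ ->
  lam - len F <= pos s - pos r <= len FP' + len FQ' ->
  (forall k l, (a <= k <= b)%N -> (a <= l <= b)%N -> at_pos P k -> at_pos Q l -> (k < l)%N) ->
  (forall k l, (r <= k <= s)%N -> (r <= l <= s)%N -> at_pos Q' k -> at_pos P' l -> (k < l)%N) ->
  False.
Proof.
move=> qt win ats in1 in2 S1 S2 o1 o2.
have w1 := quartet_wide qt; have w2 := quartet_wide (quartet_swapl (quartet_swapr qt)).
case: qt => -[h1 h2 h3 h4] [[nP nQ nP' nQ'] [_ [_ hl]]].
have posE (B : {set V}) : B \subset A -> B != set0 -> exists k, at_pos B k.
  move=> sB /set0Pn [x xB].
  have [k ek] := c_cover (subsetP A_VC _ (subsetP sB _ xB)).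
  by exists k; rewrite /at_pos -ek.
apply: (ordered_blocks m_gt0 pos_le posD counterexample_gap _ _ win _ _ _ _ o1 o2
  _ (len_ge0 lpos K) hl S1 S2 w1 w2).
- by split; apply: at_pos_periodic.
- by move=> k; rewrite /at_pos -h1 !inE -orbA.
- by move: ats; rewrite /at_pos !inE.
- by move=> k hk hPQ; apply: in1 => //; rewrite /at_pos inE.
- by move=> k hk hPQ; apply: in2 => //; rewrite /at_pos inE.
- by split; apply: posE => //; rewrite -h1; apply/subsetP => x xX; rewrite !inE xX ?orbT.
- by split; apply: len_ge0.
Qed.

Lemma counterexample_false : False.
Proof.
have [u1 [u2 [P [Q [P' [Q' [FP [FQ [FP' [FQ' [K [hA [hn
  [[s1 s2] [hc [cK hl]]]]]]]]]]]]]]]] := quartet_split lpos cFA A_gt6.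
have qt : quartet u1 u2 P Q P' Q' FP FQ FP' FQ' K by [].
case: hA hn hc => h1 h2 h3 h4 [nP nQ nP' nQ'] [cP cQ cP' cQ'].
have lPQ := lenU lpos FP FQ; have lPQ' := lenU lpos FP' FQ'.
have lK := len_ge0 lpos K.
have [|||||||a [b [r [s [win [ats [in1 in2 S1 S2]]]]]]] :=
  @counterexample_split (P :|: Q) (P' :|: Q') (FP :|: FQ) (FP' :|: FQ')
    (len FP + len FQ) (len FP' + len FQ') h1 h4.
- by case/set0Pn: nP => x xQ; apply/set0Pn; exists x; rewrite inE xQ.
- by case/set0Pn: nP' => x xQ; apply/set0Pn; exists x; rewrite inE xQ.
- by apply: connS (conn_cup cP cQ) => //; apply: subsetUr.
- by apply: connS (conn_cup cP' cQ') => //; apply: subsetUr.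
- by [].
- by [].
- lra.
have [ab br rs sam] := win; have [ata atb atr ats'] := ats.
have B1A : P :|: Q \subset A by rewrite -h1 subsetUl.
have B2A : P' :|: Q' \subset A by rewrite -h1 subsetUr.
have D1 : lam - len F <= pos b - pos a.
  by apply: (counterexample_middle B1A s1 ata atb) => //; nat_lia.
have D2 : lam - len F <= pos s - pos r.
  apply: (counterexample_middle B2A s2 atr ats') => [|k hk kB]; first nat_lia.
  have [h|h] := ltnP k (a + m).
    by have := in2 k ltac:(nat_lia) kB; nat_lia.
  (* Moved back by one period, [k] would lie in the window at [a] but before [r], against [in2]. *)
  have kB' : at_pos (P' :|: Q') (k - m)%N.
    by rewrite -(at_pos_periodic _ (k - m)%N) subnK //; nat_lia.
  by have := in2 _ _ kB'; nat_lia.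
have T1 : lam - len F <= pos b - pos a <= len FP + len FQ by rewrite D1 S1.
have T2 : lam - len F <= pos s - pos r <= len FP' + len FQ' by rewrite D2 S2.
(* Seen from the second block, the copy [a + m] is the place outside it that [quartet_order] asks
   for. *)
have atam : at_pos (P :|: Q) (a + m) by rewrite at_pos_periodic.
have O1 := quartet_order qt ab (r := r) ltac:(nat_lia) atr.
have O2 := quartet_order (quartet_swap qt) rs (r := (a + m)%N) ltac:(nat_lia) atam.
(* Given the order in the first block, [fin] settles both orders of the second by exchanging [P']
   and [Q']; using it for [P, Q] and for [Q, P] covers all four cases. *)
have fin U W FU FW : quartet u1 u2 U W P' Q' FU FW FP' FQ' K -> U :|: W = P :|: Q ->
    len FU + len FW = len FP + len FQ ->
    (forall k l, (a <= k <= b)%N -> (a <= l <= b)%N -> at_pos U k -> at_pos W l -> (k < l)%N) ->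
    False.
  move=> qt' eU eF oU; case: O2 => O2.
    apply: (quartet_ordered (quartet_swapr qt') win (r := r) (s := s)) => //;
      rewrite ?eU ?eF ?[Q' :|: P']setUC //.
    by rewrite [len FQ' + _]addrC.
  by apply: (quartet_ordered qt' win) => //; rewrite ?eU ?eF // => k k' hk hk' ? ?; apply: O2.
case: O1 => O1; first exact: fin qt _ _ O1.
apply: (fin _ _ _ _ (quartet_swapl qt)); rewrite 1?setUC 1?addrC // => k k' hk hk' ? ?.
exact: O1.
Qed.

End MinimalCounterexample.

Lemma replaceable_step (A : {set V}) : A \subset VC -> (6 < #|A|)%N -> conn EC A ->
  (forall B : {set V}, B \proper A -> replaceable B) -> replaceable A.
Proof.
move=> A_VC A_gt6 cEC IH F cF.
pose good (S : {set E}) := [&& S \subset EC, connb ends S A & len S <= len F].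
have [/existsP [S /and3P [sS /connP cS lS]]|/existsPn no] := boolP [exists S, good S].
  by exists S.
exfalso; apply: (counterexample_false A_VC A_gt6 IH cF _ cEC) => S sS /connP cS.
by have := no S; rewrite /good sS cS /= -ltNge.
Qed.

End CycleLength.

(** * From connecting edge sets to Steiner distances *)

Section SteinerDistance.
Variables (V E : finType) (ends : E -> V * V) (R : realFieldType) (l : E -> R).
Hypothesis lpos : forall e : E, 0 < l e.
Variables (VH : {set V}) (EH : {set E}).
Hypothesis H_ends : forall e, e \in EH -> ((ends e).1 \in VH) && ((ends e).2 \in VH).
Local Notation conn := (conn ends).
Local Notation len := (len l).

Lemma conn_of_witness A d : steiner_witness ends l VH EH A d ->
  exists F : {set E}, [/\ F \subset EH, conn F A & len F = d].
Proof.
move=> [VS [ES [[sV sE eE] cS AS lS]]]; exists ES; split=> // x y xA yA.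
by apply: cS; apply: (subsetP AS).
Qed.

(** Keep only the component of one terminal, with the vertices that it reaches; this does not
    increase the length. For empty [A] the empty graph serves. *)
Lemma witness_of_conn (A : {set V}) (F : {set E}) : F \subset EH -> A \subset VH -> conn F A ->
  exists2 d, steiner_witness ends l VH EH A d & d <= len F.
Proof.
move=> /subsetP sF sA cF; have [->|/set0Pn [a aA]] := eqVneq A set0.
  exists 0; last exact: len_ge0.
  exists set0, set0; split; rewrite ?len0 ?sub0set //.
    by split; rewrite ?sub0set // => e; rewrite inE.
  by move=> x y; rewrite inE.
have step e : e \in F -> connect (adj ends F) (ends e).1 (ends e).2.
  move=> eF; apply: connect1; apply/adjP; exists e => //; left; exact: surjective_pairing.
exists (len (component ends F a)); last exact: lenS (component_sub _ _ _).
exists [set v | connect (adj ends F) a v], (component ends F a); split=> //.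
- split.
  + apply/subsetP => v; rewrite inE => /connectP [p + ->].
    elim/last_ind: p => [_|p y _]; first exact: (subsetP sA).
    rewrite rcons_path last_rcons => /andP [_ /adjP [e /sF /H_ends]].
    by move=> /andP [e1 e2] [] ee; rewrite ee in e1 e2.
  + by apply/subsetP => e; rewrite inE => /andP [/sF].
  + move=> e; rewrite !inE => /andP [eF ce]; rewrite ce.
    exact: connect_trans ce (step e eF).
- move=> x y; rewrite !inE => cx cy.
  apply: connect_trans (connect_component cy).
  by rewrite connect_adjC; apply: connect_component.
- by apply/subsetP => x xA; rewrite inE; apply: cF.
Qed.

Lemma sd_exists (A : {set V}) : A \subset VH -> conn EH A ->
  exists d, is_sd ends l VH EH A d.
Proof.
move=> sA /connP cE; pose good (F : {set E}) := (F \subset EH) && connb ends F A.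
have gE : good EH by rewrite /good subxx.
have [F /andP [sF /connP cF] minF] := @arg_minP _ _ _ EH good len gE.
have [d wd dF] := witness_of_conn sF sA cF.
exists d; split=> // d' /conn_of_witness [F' [sF' /connP cF' <-]].
by apply: le_trans dF _; apply: minF; rewrite /good sF'.
Qed.

End SteinerDistance.

Theorem theorem2 (R : realFieldType) (V E : finType) (ends : E -> V * V)
  (noloop : forall e : E, (ends e).1 != (ends e).2)
  (l : E -> R) (lpos : forall e : E, 0 < l e)
  (VC : {set V}) (EC : {set E})
  (Csub : is_subgraph ends VC EC [set: V] [set: E])
  (Ccyc : is_cycle ends VC EC)
  (C6 : k_geodesic ends l 6 VC EC) :
  fully_geodesic ends l VC EC.
Proof.
have [_ C_ends conC _] := Ccyc.
have T_ends (e : E) : e \in [set: E] -> ((ends e).1 \in [set: V]) && ((ends e).2 \in [set: V]).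
  by rewrite !in_setT.
have CG A d : steiner_witness ends l VC EC A d -> steiner_witness ends l [set: V] [set: E] A d.
  by move=> [VS [ES [[? ? ?] ? ? ?]]]; exists VS, ES; split=> //; split; rewrite ?subsetT.
have connEC (A : {set V}) : A \subset VC -> conn ends EC A.
  by move=> /subsetP sA x y /sA xC /sA yC; apply: conC.
(* The hypothesis [C6] relates only distances that are attained, so [sd_exists] first provides the
   one in the cycle. *)
have small (A : {set V}) : (#|A| <= 6)%N -> A \subset VC -> replaceable ends l EC A.
  move=> A6 AC F cF.
  have [d sdC] := sd_exists lpos C_ends AC (connEC A AC).
  have [_ minG] := (C6 A AC A6 d).1 sdC.
  have [S [sS cS lS]] := conn_of_witness sdC.1.
  have [d' wd' ld'] := witness_of_conn lpos T_ends (subsetT F) (subsetT A) cF.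
  by exists S; split=> //; rewrite lS; apply: le_trans (minG _ wd') ld'.
have [m [c [ed [[m0 cper edper] [[cinj edinj edj] [ccov edEC edcov]]]]]] :=
  cycle_parametrization noloop Ccyc.
(* Induction on a bound for the size makes all proper subsets available to [replaceable_step]. *)
have short n (A : {set V}) : (#|A| <= n)%N -> A \subset VC -> replaceable ends l EC A.
  elim: n A => [|n IH] A An AC; first by apply: small => //; apply: leq_trans An _.
  have [A6|A6] := leqP #|A| 6; first exact: small.
  apply: (replaceable_step noloop lpos m0 cper edper cinj edinj edj ccov edEC edcov AC A6
    (connEC A AC)) => B pB; apply: IH; last exact: subset_trans (proper_sub pB) AC.
  by rewrite -ltnS; apply: leq_trans (proper_card pB) An.
move=> k A AC _ d; split=> -[wd mind].
  split; first exact: CG.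
  move=> d' /conn_of_witness [F [_ cF <-]].
  have [S [sS cS lS]] := short _ A (leqnn _) AC F cF.
  have [d'' wd'' ld''] := witness_of_conn lpos C_ends sS AC cS.
  exact: le_trans (mind _ wd'') (le_trans ld'' lS).
have [F [_ cF lF]] := conn_of_witness wd.
have [S [sS cS lS]] := short _ A (leqnn _) AC F cF.
have [d'' wd'' ld''] := witness_of_conn lpos C_ends sS AC cS.
(* A witness in the cycle is also one in the whole graph, so [d''] is at least the minimum [d]; it
   is at most [d] because [S] replaces [F]. *)
have dd : d'' = d.
  by apply/eqP; rewrite eq_le mind ?andbT -?lF ?(le_trans ld'') //; apply: CG.
subst d''; split=> // d' /CG; exact: mind.
Qed.
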